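(* Let $p$ be a prime, $G=\langle g\rangle$ a cyclic group of order $p$, $L=\mathbb{Z}_pG$, and let $A$ be a finite $\mathbb{Z}_pG$-module of rank $1$ with invariants $r$, $s$ and $t$ (as defined in the context). Then: (i) There exists a unique submodule $M\subseteq L$ such that $A\cong L/M$; namely - $M=L$ if $s=0$, - $M=\langle g-1,\ p^s\rangle$ if $r=0$ and $s\geq 1$, and - $M=\langle (g-1)^{r+1},\ p^s-\varepsilon^s(g-1)^{s(p-1)}-t(g-1)^{r}\rangle$ if $r,s\geq 1$. (ii) $A$ is completely determined up to isomorphism by the invariants $r$, $s$ and $t$; in other words, if $A'$ is a finite quotient of $\mathbb{Z}_pG$ having the same invariants as $A$, then $A'\cong A$. (iii) For $r,s\geq 1$, $A$ is cohomologically trivial if and only if $t\neq 0$. (For $rs=0$, $G$ acts trivially on $A$, and $A$ is cohomologically trivial if and only if $s=0$, or equivalently $A=0$.)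
   Context: $\mathbb{Z}_p$ is the ring of $p$-adic integers. A $\mathbb{Z}_pG$-module ''of rank $1$'' means a cyclic module, i.e. one isomorphic to a quotient of $\mathbb{Z}_pG$ (the zero module is allowed). A ''generator'' of $A$ is a generator over $\mathbb{Z}_pG$. $\langle\cdots\rangle$ inside $L$ denotes the $\mathbb{Z}_pG$-submodule generated by the listed elements. Submodule means $\mathbb{Z}_pG$-submodule. Let $B=[A,G]=(g-1)A$ and let $A^G$ be the submodule of $G$-fixed elements. The invariants $r,s$ are defined by $p^r=|B|$, $p^s=|A^G|$. Let $\mathfrak{O}=\mathbb{Z}_p[\zeta]$ with $\zeta$ a primitive $p$-th root of $1$, $\mathfrak{P}=(\zeta-1)\mathfrak{O}$ its maximal ideal, and let $\varepsilon\in\mathfrak{O}^\times$ be the unit with $p=\varepsilon(\zeta-1)^{p-1}$. With $N=1+g+\cdots+g^{p-1}$, any $\mathbb{Z}_pG$-module annihilated by $N$ is an $\mathfrak{O}$-module with $\zeta$ acting as $g$. This applies to $B$ and to the augmentation ideal $\mathfrak{I}_G=(g-1)\mathbb{Z}_pG$ of $\mathbb{Z}_pG$; in particular $\varepsilon^s(g-1)^{s(p-1)}$ denotes the action of $\varepsilon^s\in\mathfrak{O}$ on the element $(g-1)^{s(p-1)}\in\mathfrak{I}_G$. The invariant $t\in\mathbb{F}_p$: if $r,s\geq 1$, choose a generator $a$ of $A$ and put $b=(g-1)a$. Then $t$ is the unique element of $\mathbb{F}_p$ with $$p^sa=\left(\varepsilon^s(\zeta-1)^{s(p-1)-1}+t(\zeta-1)^{r-1}\right)b;$$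 such a $t$ exists, and it does not depend on the choice of $a$ (here $t$ may be replaced by any integer lift, since $p(\zeta-1)^{r-1}b=0$). If $rs=0$, set $t=0$. In the description of $M$, $t(g-1)^r$ is likewise formed using any integer lift of $t$ (the choice does not matter modulo $\langle (g-1)^{r+1}\rangle$). $A$ is cohomologically trivial if the Tate cohomology groups $\hat H^n(H,A)$ vanish for all $n\in\mathbb{Z}$ and all subgroups $H\le G$; for $G$ of order $p$ this amounts to $\hat H^n(G,A)=0$ for all $n$. *)

(* Defs.v *)
From HB Require Import structures.
From mathcomp Require Import all_boot all_order all_algebra all_fingroup.
From mathcomp Require Import generic_quotient ring_quotient qpoly.
From mathcomp Require Import boolp.

Set Implicit Arguments.
Unset Strict Implicit.
Unset Printing Implicit Defensive.

Import GRing.Theory.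
Local Open Scope ring_scope.

Section ZpReduction.
Variables (m m' : nat).
Hypothesis dvd_mm' : (m.+2 %| m'.+2)%N.

Let red (x : 'I_m'.+2) : 'I_m.+2 := inZp (val x).

Fact inZp_is_zmod_morphism : zmod_morphism red.
Proof.
have redD x y : red (x + y) = red x + red y.
  by apply/val_inj; rewrite /= modn_dvdm // modnDm.
by move=> x y; have := redD (x - y) y; rewrite subrK => ->; rewrite addrK.
Qed.

Fact inZp_is_monoid_morphism : monoid_morphism red.
Proof.
split; first by apply/val_inj; rewrite /= modn_dvdm.
by move=> x y; apply/val_inj; rewrite /= modn_dvdm // modnMm.
Qed.

End ZpReduction.

(* The p-adic integers, as the inverse limit of the rings Z/p^(n+1).          *)
(* ('Z_m has modulus 2 for m = 0, 1, so exponents start at 1. The ring        *)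
(* structure is defined for every p, but is only meaningful for p > 1.)       *)
Section Padic.
Variable p : nat.

Definition zp_red n (x : 'Z_(p ^ n.+2)) : 'Z_(p ^ n.+1) := inZp (val x).

Record padic : Type := Padic {
  padic_proj :> forall n, 'Z_(p ^ n.+1);
  padic_coh : forall n, zp_red (padic_proj n.+1) = padic_proj n
}.

HB.instance Definition _ := gen_eqMixin padic.
HB.instance Definition _ := gen_choiceMixin padic.

Lemma padic_eqP (x y : padic) : (forall n, x n = y n) -> x = y.
Proof.
case: x y => [x cx] [y cy] /= exy.
have exy' : x = y by apply: functional_extensionality_dep.
by rewrite exy' in cx *; congr Padic; apply: Prop_irrelevance.
Qed.

Lemma zp_modulus_dvd n :
  ((Zp_trunc (p ^ n.+1)).+2 %| (Zp_trunc (p ^ n.+2)).+2)%N.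
Proof.
have [p_gt1|] := ltnP 1 p.
  have pX_gt1 k : (1 < p ^ k.+1)%N by rewrite -(exp1n k.+1) ltn_exp2r.
  by rewrite !Zp_cast // (expnS _ n.+1) dvdn_mull.
by rewrite /Zp_trunc; case: p => [|[|//]] _; rewrite ?exp1n // !exp0n.
Qed.

Fact zp_red_is_zmod_morphism n : zmod_morphism (@zp_red n).
Proof. exact: inZp_is_zmod_morphism (zp_modulus_dvd n). Qed.

HB.instance Definition _ n :=
  GRing.isZmodMorphism.Build _ _ (@zp_red n) (@zp_red_is_zmod_morphism n).

Fact zp_red_is_monoid_morphism n : monoid_morphism (@zp_red n).
Proof. exact: inZp_is_monoid_morphism (zp_modulus_dvd n). Qed.

HB.instance Definition _ n :=
  GRing.isMonoidMorphism.Build _ _ (@zp_red n) (@zp_red_is_monoid_morphism n).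

Definition padic0 := @Padic (fun=> 0) (fun n => rmorph0 (@zp_red n)).
Definition padic1 := @Padic (fun=> 1) (fun n => rmorph1 (@zp_red n)).
Definition padic_opp (x : padic) : padic.
Proof. by exists (fun n => - x n) => n; rewrite rmorphN /= padic_coh. Defined.
Definition padic_add (x y : padic) : padic.
Proof. by exists (fun n => x n + y n) => n; rewrite rmorphD /= !padic_coh. Defined.
Definition padic_mul (x y : padic) : padic.
Proof. by exists (fun n => x n * y n) => n; rewrite rmorphM /= !padic_coh. Defined.

Fact padic_addA : associative padic_add.
Proof. by move=> x y z; apply: padic_eqP => n; exact: addrA. Qed.
Fact padic_addC : commutative padic_add.
Proof. by move=> x y; apply: padic_eqP => n; exact: addrC. Qed.
Fact padic_add0 : left_id padic0 padic_add.
Proof. by move=> x; apply: padic_eqP => n; exact: add0r. Qed.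
Fact padic_addN : left_inverse padic0 padic_opp padic_add.
Proof. by move=> x; apply: padic_eqP => n; exact: addNr. Qed.

HB.instance Definition _ :=
  GRing.isZmodule.Build padic padic_addA padic_addC padic_add0 padic_addN.

Fact padic_mulA : associative padic_mul.
Proof. by move=> x y z; apply: padic_eqP => n; exact: mulrA. Qed.
Fact padic_mulC : commutative padic_mul.
Proof. by move=> x y; apply: padic_eqP => n; exact: mulrC. Qed.
Fact padic_mul1 : left_id padic1 padic_mul.
Proof. by move=> x; apply: padic_eqP => n; exact: mul1r. Qed.
Fact padic_mulDl : left_distributive padic_mul +%R.
Proof. by move=> x y z; apply: padic_eqP => n; exact: mulrDl. Qed.
Fact padic_1_neq0 : padic1 != 0.
Proof.
by apply/eqP => /(congr1 (fun x : padic => x 0%N)) /eqP; rewrite oner_eq0.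
Qed.

HB.instance Definition _ := GRing.Zmodule_isComNzRing.Build padic
  padic_mulA padic_mulC padic_mul1 padic_mulDl padic_1_neq0.

End Padic.

(* The group algebra R[gT]: functions gT -> R with the convolution product.   *)
Section GroupAlgebra.
Variables (R : comNzRingType) (gT : finGroupType).

Definition group_algebra : Type := {ffun gT -> R}.

HB.instance Definition _ := GRing.Lmodule.copy group_algebra {ffun gT -> R^o}.

Definition ga_coef (x : group_algebra) (h : gT) : R := (x : {ffun gT -> R}) h.

(* The element of R[gT] corresponding to the group element k. *)
Definition gelt (k : gT) : group_algebra := [ffun h => (h == k)%:R].

Definition ga_mul (x y : group_algebra) : group_algebra :=
  [ffun h => \sum_k ga_coef x k * ga_coef y (k^-1 * h)%g].

Fact ga_mulA : associative ga_mul.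
Proof.
move=> x y z; apply/ffunP => h; rewrite !ffunE.
under eq_bigr do rewrite /ga_coef ffunE big_distrr /=.
under [RHS]eq_bigr do rewrite /ga_coef ffunE big_distrl /=.
rewrite [RHS]exchange_big /=; apply: eq_bigr => k _.
rewrite [RHS](reindex_inj (mulgI k)) /=; apply: eq_bigr => l _.
by rewrite /ga_coef mulKg mulrA invMg mulgA.
Qed.

Fact ga_mul1 : left_id (gelt 1%g) ga_mul.
Proof.
move=> x; apply/ffunP => h; rewrite ffunE (bigD1 1%g) //= /ga_coef ffunE eqxx mul1r.
rewrite invg1 mul1g big1 ?addr0 // => k /negPf k1.
by rewrite ffunE k1 mul0r.
Qed.

Fact ga_mulr1 : right_id (gelt 1%g) ga_mul.
Proof.
move=> x; apply/ffunP => h; rewrite ffunE (bigD1 h) //= /ga_coef ffunE mulVg eqxx.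
rewrite mulr1 big1 ?addr0 // => k /negPf kh.
by rewrite ffunE -eq_mulVg1 kh mulr0.
Qed.

Fact ga_mulDl : left_distributive ga_mul +%R.
Proof.
move=> x y z; apply/ffunP => h; rewrite !ffunE -big_split /=.
by apply: eq_bigr => k _; rewrite /ga_coef ffunE mulrDl.
Qed.

Fact ga_mulDr : right_distributive ga_mul +%R.
Proof.
move=> x y z; apply/ffunP => h; rewrite !ffunE -big_split /=.
by apply: eq_bigr => k _; rewrite /ga_coef ffunE mulrDr.
Qed.

Fact ga_1_neq0 : gelt 1%g != 0.
Proof. by apply/eqP => /ffunP/(_ 1%g)/eqP; rewrite !ffunE eqxx oner_eq0. Qed.

HB.instance Definition _ := GRing.Zmodule_isNzRing.Build group_algebra
  ga_mulA ga_mul1 ga_mulr1 ga_mulDl ga_mulDr ga_1_neq0.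

Fact ga_scaleAl (a : R) (x y : group_algebra) : a *: (x * y) = (a *: x) * y.
Proof.
apply/ffunP => h; rewrite !ffunE -[LHS]/(a * _) big_distrr /=.
by apply: eq_bigr => k _; rewrite /ga_coef ffunE -[a *: _]/(a * _) mulrA.
Qed.

HB.instance Definition _ :=
  GRing.Lmodule_isLalgebra.Build R group_algebra ga_scaleAl.

Fact ga_scaleAr (a : R) (x y : group_algebra) : a *: (x * y) = x * (a *: y).
Proof.
apply/ffunP => h; rewrite !ffunE -[LHS]/(a * _) big_distrr /=.
by apply: eq_bigr => k _; rewrite /ga_coef ffunE -[a *: _]/(a * _) mulrCA.
Qed.

HB.instance Definition _ :=
  GRing.Lalgebra_isAlgebra.Build R group_algebra ga_scaleAr.

End GroupAlgebra.

Arguments gelt {R gT} k.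

(* Quotients V / M of a left module by a submodule. *)
Section QuotientModule.
Variables (R : nzRingType) (V : lmodType R) (M : submodClosed V).

Fact submod_zmod_closed : zmod_closed M.
Proof.
split=> [|x y Mx My]; first exact: rpred0.
by rewrite rpredD // -scaleN1r rpredZ.
Qed.

Definition submod_zmod : zmodClosed V :=
  HB.pack (M : {pred V})
    (GRing.isZmodClosed.Build V (M : {pred V}) submod_zmod_closed).

Definition quot_module : Type := (Quotient.quot submod_zmod).

HB.instance Definition _ := GRing.Zmodule.copy quot_module (Quotient.quot submod_zmod).

Definition quot_proj (v : V) : quot_module := (\pi_((Quotient.quot submod_zmod)) v)%qT.

Fact quot_projP u v : quot_proj u = quot_proj v <-> u - v \in M.
Proof. by split=> [/eqP|Muv]; [|apply/eqP]; rewrite -Quotient.idealrBE. Qed.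

Definition quot_repr (u : quot_module) : V := repr (u : (Quotient.quot submod_zmod)).

Fact quot_reprK : cancel quot_repr quot_proj.
Proof. exact: reprK. Qed.

Fact quot_projD : {morph quot_proj : u v / u + v}.
Proof. exact: raddfD. Qed.

Definition quot_scale (a : R) (u : quot_module) : quot_module :=
  quot_proj (a *: quot_repr u).

Fact quot_scaleE a v : quot_scale a (quot_proj v) = quot_proj (a *: v).
Proof.
by apply/quot_projP; rewrite -scalerBr rpredZ //; apply/quot_projP/quot_reprK.
Qed.

Fact quot_scaleA a b u : quot_scale a (quot_scale b u) = quot_scale (a * b) u.
Proof. by rewrite -(quot_reprK u) !quot_scaleE scalerA. Qed.

Fact quot_scale1 : left_id 1 quot_scale.
Proof. by move=> u; rewrite -(quot_reprK u) quot_scaleE scale1r. Qed.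

Fact quot_scaleDr : right_distributive quot_scale +%R.
Proof.
move=> a u v; rewrite -(quot_reprK u) -(quot_reprK v) -quot_projD !quot_scaleE.
by rewrite scalerDr quot_projD.
Qed.

Fact quot_scaleDl u : {morph quot_scale^~ u : a b / a + b}.
Proof.
by move=> a b; rewrite -(quot_reprK u) !quot_scaleE scalerDl quot_projD.
Qed.

HB.instance Definition _ := GRing.Zmodule_isLmodule.Build R quot_module
  quot_scaleA quot_scale1 quot_scaleDr quot_scaleDl.

Fact quot_proj_is_linear : linear quot_proj.
Proof. by move=> a u v; rewrite quot_projD -quot_scaleE. Qed.

HB.instance Definition _ :=
  GRing.isLinear.Build R V quot_module _ quot_proj quot_proj_is_linear.

End QuotientModule.

Definition lmod_iso (R : nzRingType) (U V : lmodType R) : Prop :=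
  exists f : {linear U -> V}, bijective f.

(* "Rank 1": isomorphic to a quotient of the regular module. *)
Definition rank1 (R : nzRingType) (V : lmodType R) : Prop :=
  exists M : submodClosed R^o, lmod_iso V (quot_module M).

Definition mod_generator (R : nzRingType) (V : lmodType R) (v : V) : Prop :=
  forall x : V, exists c : R, x = c *: v.

(* The submodule generated by the elements of s. *)
Definition span_mod (R : nzRingType) (V : lmodType R) (s : seq V) : {pred V} :=
  fun v => `[< exists c : 'I_(size s) -> R, v = \sum_i c i *: s`_i >].

(* Tate cohomology of a subgroup H of gT with values in an R[gT]-module A,    *)
(* computed by the complete standard complex: for n >= 0, both X^n and        *)
(* X^(-1-n) consist of the maps H^(n+1) -> A (commuting with H, for the       *)
(* complex of invariants), with                                               *)
(*   (d x)(s_0,..,s_n) = \sum_i (-1)^i x(s_0,..,^s_i,..,s_n)                  *)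
(* from X^(n-1) to X^n for n >= 1 (the argument s_i is omitted),              *)
(*   (d x)(s_0) = \sum_t x(t)                                                 *)
(* from X^(-1) to X^0, and                                                    *)
(*   (d x)(s_0,..,s_(n-1)) = \sum_t \sum_i (-1)^i x(s_0,..,s_(i-1),t,s_i,..)  *)
(* from X^(-1-n) to X^(-n) for n >= 1.                                        *)
Section Tate.
Variables (R : comNzRingType) (gT : finGroupType).
Variables (A : lmodType (group_algebra R gT)) (H : {group gT}).

Definition ga_act (h : gT) (x : A) : A := (gelt h : group_algebra R gT) *: x.

Definition cochain n := {ffun 'I_n.+1 -> subg_of H} -> A.

Definition equivariant n (x : cochain n) : Prop :=
  forall (h : subg_of H) (s : {ffun 'I_n.+1 -> subg_of H}),
    x [ffun i => (h * s i)%g] = ga_act (sgval h) (x s).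

Definition omit n (i : 'I_n.+1) (s : {ffun 'I_n.+1 -> subg_of H}) :
  {ffun 'I_n -> subg_of H} := [ffun j => s (lift i j)].

Definition insert n (i : 'I_n.+1) (t : subg_of H)
    (s : {ffun 'I_n -> subg_of H}) : {ffun 'I_n.+1 -> subg_of H} :=
  [ffun j => if unlift i j is Some k then s k else t].

Definition d_pos n (x : cochain n) : cochain n.+1 :=
  fun s => \sum_(i < n.+2) (-1) ^+ i *: x (omit i s).

Definition d_norm (x : cochain 0) : cochain 0 :=
  fun _ => \sum_(t : subg_of H) x [ffun=> t].

Definition d_neg n (x : cochain n.+1) : cochain n :=
  fun s => \sum_(t : subg_of H) \sum_(i < n.+2) (-1) ^+ i *: x (insert i t s).

Definition tate_deg (n : int) : nat :=
  match n with Posz m => m | Negz m => m end.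

Definition tate_cocycle (n : int) : cochain (tate_deg n) -> Prop :=
  match n return cochain (tate_deg n) -> Prop with
  | Posz m => fun x => equivariant x /\ forall s, d_pos x s = 0
  | Negz 0 => fun x => equivariant x /\ forall s, d_norm x s = 0
  | Negz m.+1 => fun x => equivariant x /\ forall s, d_neg x s = 0
  end.

Definition tate_coboundary (n : int) : cochain (tate_deg n) -> Prop :=
  match n return cochain (tate_deg n) -> Prop with
  | Posz 0 => fun x => exists2 y : cochain 0, equivariant y & x =1 d_norm y
  | Posz m.+1 => fun x => exists2 y : cochain m, equivariant y & x =1 d_pos y
  | Negz m => fun x => exists2 y : cochain m.+1, equivariant y & x =1 d_neg y
  end.

(* The vanishing of the Tate cohomology group of degree n. *)
Definition tate_vanish (n : int) : Prop :=
  forall x : cochain (tate_deg n), tate_cocycle x -> tate_coboundary x.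

End Tate.

Definition cohomologically_trivial (R : comNzRingType) (gT : finGroupType)
    (A : lmodType (group_algebra R gT)) : Prop :=
  forall (H : {group gT}) (n : int), tate_vanish A H n.

(* Z_p[zeta], as the quotient of Z_p[X] by 1 + X + ... + X^(p-1). *)
Definition cyclo_poly (p : nat) : {poly padic p} := \sum_(i < p) 'X^i.

(* {poly %/ h} is the quotient by mk_monic h, which is h only if h is monic   *)
(* of positive degree.                                                        *)
Lemma mk_monic_cyclo_poly (p : nat) :
  prime p -> mk_monic (cyclo_poly p) = cyclo_poly p.
Proof.
case: p => [//|p] p_pr; have p_gt0 : (0 < p)%N by rewrite -ltnS prime_gt1.
have sz : size (cyclo_poly p.+1) = p.+1.
  rewrite /cyclo_poly big_ord_recr /= addrC size_polyDl size_polyXn // ltnS.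
  apply: (leq_trans (size_sum _ _ _)); apply/bigmax_leqP => i _.
  by rewrite size_polyXn.
rewrite /mk_monic sz ltnS p_gt0 /= monicE lead_coefE sz /cyclo_poly coef_sum.
rewrite big_ord_recr /= coefXn eqxx big1 ?add0r ?eqxx // => i _.
by rewrite coefXn gtn_eqF.
Qed.

Definition cyclo_int (p : nat) := {poly %/ cyclo_poly p}.

HB.instance Definition _ p := GRing.ComNzRing.on (cyclo_int p).

Definition zeta (p : nat) : cyclo_int p := in_qpoly (cyclo_poly p) 'X.

Section Invariants.
Variables (p : nat) (gT : finGroupType) (g : gT).
Let L := group_algebra (padic p) gT.

(* The action of Z_p[zeta] on a module annihilated by the norm element of g,  *)
(* with zeta acting as g: lift x to Z_p[X] and evaluate at g. This is not an  *)
(* action on a general V, but is used only on elements of submodules          *)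
(* annihilated by the norm.                                                   *)
Definition cyclo_act (V : lmodType L) (x : cyclo_int p) (v : V) : V :=
  horner_alg (gelt g : L) (polyn x) *: v.

(* eps is the unit of Z_p[zeta] with p = eps (zeta - 1)^(p-1). *)
Definition is_eps (eps : cyclo_int p) : Prop :=
  (exists eps' : cyclo_int p, eps * eps' = 1)
  /\ p%:R = eps * (zeta p - 1) ^+ p.-1.

Variables (eps : cyclo_int p) (A : finLmodType L).

Definition aug_image : {set A} := [set (gelt g - 1 : L) *: x | x : A].

Definition fixed_points : {set A} := [set x | [forall h : gT, ga_act h x == x]].

(* For p prime, a finite Z_p-module has order a power of p, so inv_r and inv_s *)
(* are the exponents with p^r = |aug_image| and p^s = |fixed_points|.          *)
Definition inv_r : nat := logn p #|aug_image|.
Definition inv_s : nat := logn p #|fixed_points|.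

(* The coercion of t to nat is the lift in [0, p). *)
Definition is_inv_t (a : A) (t : 'F_p) : Prop :=
  a *+ (p ^ inv_s) =
    cyclo_act (eps ^+ inv_s * (zeta p - 1) ^+ (inv_s * p.-1).-1
               + (t : nat)%:R * (zeta p - 1) ^+ inv_r.-1)
              ((gelt g - 1 : L) *: a).

(* For A finite of rank 1 such a t exists and does not depend on the generator; *)
(* the default value 0 of odflt is then not reached.                            *)
Definition inv_t : 'F_p :=
  if (inv_r == 0%N) || (inv_s == 0%N) then 0
  else odflt 0 [pick t | `[< exists2 a, mod_generator a & is_inv_t a t >]].

End Invariants.

(* Main.v *)
Require Import Defs.
From HB Require Import structures.
From mathcomp Require Import all_boot all_order all_algebra all_fingroup.
From mathcomp Require Import qpoly boolp cyclic.
From mathcomp Require Import zify.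

Set Implicit Arguments.
Unset Strict Implicit.
Unset Printing Implicit Defensive.

Import GRing.Theory.
Local Open Scope ring_scope.

(** Write [w = g - 1], let [N] be the norm element and let [E] be a lift to
    L = Z_p[G] of the unit [eps]. As [w * N = 0], the relation
    p = eps (zeta - 1)^(p-1) becomes [p w = E w^p] in L ([aug_p]), and [E] acts
    invertibly on multiples of [w] ([aug_eps_unit]). Together with L/(w) = Z_p
    this says that every element of L is, modulo [w] and [p^n], a natural
    number below [p^n], and that every multiple of [w] is [w] times a digit
    [i < p] modulo [w^2] ([ga_digits], [aug_digit]).

    Let [A] be finite and cyclic with generator [a]. Then [p], hence also [w],
    is nilpotent on [A]. Counting digits along the filtration of wA by the
    w^i wA shows that [r] is the first exponent with w^r w a = 0 ([inv_rP]).
    The map x |-> w x gives |A| = |wA| |A^G|, so |A^G| = |A / wA| and [s] is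
    the first exponent with p^s a in wA ([inv_sP]). The difference of p^s a and
    E^s w^(s(p-1)) a is killed by [w], so it is a multiple [t w^r a] of the
    last nonzero power, which is the invariant [t] ([inv_t_exists]). Reducing
    an element of the annihilator of [a] by digits then yields the stated
    generators of [M], and [M] is the annihilator of [a] ([ann_rs], [ann_r0]).
    Cyclic modules over a commutative ring are classified by the annihilator of
    a generator ([cyclic_iso]). This settles existence and uniqueness of [M], and
    [M] depends on [r], [s], [t] only.

    For cohomological triviality put u = p^s - E^s w^(s(p-1)) - t w^r. Then
    [w u = - t w^(r+1)]. If [t] is nonzero it is a unit of Z_p, so [M] is
    generated by [u]; and [u] is not a zero divisor, so A = L/uL has the free
    resolution 0 -> L -> L -> A -> 0 and inherits vanishing cohomology from L
    ([cohomologically_trivial_regular_quotient]). If [t = 0], the identity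
    [N = p - E w^(p-1)] ([ga_normE]) gives p^(s-1) N a = u a = 0, so N A has at
    most p^(s-1) elements while A^G has p^s, and H^0 is not zero.

    The vanishing for L holds in all degrees of the complete standard complex
    at once. All its differentials are integer matrices built from the bar
    differential [bar] and its transpose, the norm map being the product of the
    augmentation with its transpose. A single recursion ([bar_rec]) shows that
    squares vanish ([bar_bar]) and that prepending 1 is a contracting homotopy
    ([bar_contract]); the latter becomes equivariant on functions with values
    in L after composition with the projection of L onto a transversal and
    summation over the group ([exact_at_regular]). *)

(** * Integer kernels acting on functions *)

Section Kernel.
Variables (X Y Z : finType).

Definition kmul (K : X -> Y -> int) (K' : Y -> Z -> int) : X -> Z -> int :=
  fun x z => \sum_y K x y * K' y z.

Definition ktr (K : X -> Y -> int) : Y -> X -> int := fun y x => K x y.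

Definition kid : X -> X -> int := fun x x' => (x == x')%:R.

(** The entries are integers and the values lie in an arbitrary abelian group:
    an identity between kernels holds for all coefficient modules at once, and
    the homology side of the complete complex is the transpose of the
    cohomology side. *)
Definition kapp (V : zmodType) (K : X -> Y -> int) (f : Y -> V) : X -> V :=
  fun x => \sum_y f y *~ K x y.

End Kernel.
Arguments kid {X}.

Section KernelTheory.
Variables (X Y Z T : finType).
Implicit Types (K : X -> Y -> int).

Lemma kmulA K (K' : Y -> Z -> int) (K'' : Z -> T -> int) :
  kmul K (kmul K' K'') = kmul (kmul K K') K''.
Proof.
apply/funext => x; apply/funext => t; rewrite /kmul.
under eq_bigr do rewrite big_distrr /=.
rewrite exchange_big /=; apply: eq_bigr => z _.
by rewrite big_distrl /=; apply: eq_bigr => y _; rewrite mulrA.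
Qed.

Lemma kmulr1 K : kmul K kid = K.
Proof.
apply/funext => x; apply/funext => y; rewrite /kmul (bigD1 y) //= /kid eqxx mulr1.
by rewrite big1 ?addr0 // => y' /negPf ->; rewrite mulr0.
Qed.

Lemma kmul_deltal (f : X -> Y) (K : Y -> Z -> int) x z :
  kmul (fun x y => (y == f x)%:R) K x z = K (f x) z.
Proof.
rewrite /kmul (bigD1 (f x)) //= eqxx mul1r big1 ?addr0 // => y /negPf ->.
by rewrite mul0r.
Qed.

Lemma ktr_mul K (K' : Y -> Z -> int) : ktr (kmul K K') = kmul (ktr K') (ktr K).
Proof.
apply/funext => z; apply/funext => x; apply: eq_bigr => y _.
by rewrite /ktr mulrC.
Qed.

Lemma kapp_mul (V : zmodType) K (K' : Y -> Z -> int) (f : Z -> V) :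
  kapp (kmul K K') f = kapp K (kapp K' f).
Proof.
apply/funext => x; rewrite /kapp /kmul.
under [RHS]eq_bigr do rewrite mulrz_suml.
rewrite [RHS]exchange_big /=; apply: eq_bigr => z _.
by rewrite mulrz_sumr; apply: eq_bigr => y _; rewrite -mulrzA mulrC.
Qed.

Lemma kapp_add (V : zmodType) K K' (f : Y -> V) x :
  kapp (fun x y => K x y + K' x y) f x = kapp K f x + kapp K' f x.
Proof.
by rewrite /kapp -big_split; apply: eq_bigr => y _; rewrite mulrzDr.
Qed.

Lemma kapp1 (V : zmodType) (f : X -> V) : kapp kid f = f.
Proof.
apply/funext => x; rewrite /kapp (bigD1 x) //= /kid eqxx mulr1z.
by rewrite big1 ?addr0 // => x' /negPf; rewrite eq_sym => ->; rewrite mulr0z.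
Qed.

Lemma kapp0 (V : zmodType) K : kapp K (fun=> 0 : V) = fun=> 0.
Proof. by apply/funext => x; apply: big1 => y _; rewrite mul0rz. Qed.

Lemma kappB (V : zmodType) K (f f' : Y -> V) x :
  kapp K (fun y => f y - f' y) x = kapp K f x - kapp K f' x.
Proof.
by rewrite /kapp -sumrB; apply: eq_bigr => y _; rewrite mulrzBl.
Qed.

End KernelTheory.

(** * The bar differential *)

Section Bar.
Variable (T : finType).

Local Notation tup n := {ffun 'I_n -> T}.

Definition bar_cons n (h : T) (s : tup n) : tup n.+1 :=
  [ffun i => if unlift ord0 i is Some j then s j else h].

Definition bar_tail n (s : tup n.+1) : tup n := [ffun j => s (lift ord0 j)].

Lemma bar_cons_inj n h h' (s s' : tup n) :
  (bar_cons h s == bar_cons h' s') = (h == h') && (s == s').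
Proof.
apply/eqP/andP => [/ffunP e|[/eqP-> /eqP->] //].
split; first by have := e ord0; rewrite !ffunE unlift_none => ->.
apply/eqP/ffunP => j; have := e (lift ord0 j).
by rewrite !ffunE liftK.
Qed.

Lemma bar_consK n (s : tup n.+1) : bar_cons (s ord0) (bar_tail s) = s.
Proof.
by apply/ffunP => i; rewrite ffunE; case: unliftP => [j|] ->; rewrite ?ffunE.
Qed.

Lemma big_bar_cons n (F : tup n.+1 -> int) :
  \sum_s F s = \sum_h \sum_s F (bar_cons h s).
Proof.
rewrite pair_bigA /= (reindex (fun p : T * tup n => bar_cons p.1 p.2)) //.
exists (fun s : tup n.+1 => (s ord0, bar_tail s)) => [[h s]|s] _ /=; last by rewrite bar_consK.
congr pair; first by rewrite ffunE unlift_none.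
by apply/ffunP => j; rewrite !ffunE liftK.
Qed.

(** The boundary of the standard resolution, the row of [s] being the
    alternating sum of its faces. For [n = 0] this is the augmentation, the only
    face of a 1-tuple being the empty tuple; it is included so that identities
    start one degree lower. *)
Definition bar n : tup n.+1 -> tup n -> int :=
  fun s s' => \sum_(i < n.+1) (-1) ^+ i * ([ffun j => s (lift i j)] == s')%:R.

Lemma bar0 s s' : @bar 0 s s' = 1.
Proof.
rewrite /bar big_ord1 mul1r (_ : _ == _ = true) //.
by apply/eqP/ffunP; case.
Qed.

(** The face that omits the first entry of [h :: s] is [s]; all other faces keep
    [h] and are, with the opposite sign, faces of [s]. *)
Lemma bar_rec n h (s : tup n.+1) h' (s' : tup n) :
  bar (bar_cons h s) (bar_cons h' s')
    = (s == bar_cons h' s')%:R - (h == h')%:R * bar s s'.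
Proof.
rewrite {1}/bar big_ord_recl mul1r; congr (_ + _).
  congr (_ == _)%:R; apply/ffunP => j.
  by rewrite !ffunE liftK.
rewrite /bar big_distrr -sumrN; apply: eq_bigr => i _ /=.
have -> : [ffun j => bar_cons h s (lift (lift ord0 i) j)]
          = bar_cons h [ffun j => s (lift i j)].
  apply/ffunP => j; rewrite !ffunE.
  case: (unliftP (ord0 : 'I_n.+1) j) => [k|] ->; last first.
    by rewrite (_ : lift _ _ = ord0) ?unlift_none //; apply/val_inj.
  rewrite (_ : lift _ _ = lift ord0 (lift i k)) ?liftK ?ffunE //.
  by apply/val_inj; rewrite /= /bump; lia.
rewrite bar_cons_inj exprS mulN1r mulNr; congr (- _).
by case: (h == h'); rewrite ?mul1r ?mul0r ?mulr0.
Qed.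

End Bar.

Section BarComplex.
Variable (T : finType).

Local Notation tup n := {ffun 'I_n -> T}.
Local Notation D n := (@bar T n).

(** Expanding both factors by [bar_rec] on the first entries, the two terms
    that contain a single [bar] cancel and the remaining one is the same
    product one degree lower. *)
Lemma bar_bar n : kmul (D n.+1) (D n) = fun _ _ => 0.
Proof.
elim: n => [|n IHn]; apply/funext => s; apply/funext => s''; rewrite /kmul.
  under eq_bigr do rewrite bar0 mulr1.
  rewrite /bar exchange_big /= !big_ord_recl big_ord0 /=.
  have sum1 (s' : tup 1) : \sum_(i : tup 1) (s' == i)%:R = 1 :> int.
    rewrite (bigD1 s') //= eqxx big1 ?addr0 // => i /negPf; rewrite eq_sym => ->.
    by [].
  by rewrite -!big_distrr /= !sum1.
rewrite -(bar_consK s) -(bar_consK s'') big_bar_cons.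
move: (s ord0) (bar_tail s) (s'' ord0) (bar_tail s'') => {s s''} h s h'' s''.
under eq_bigr => h' _ do under eq_bigr => s' _ do rewrite bar_rec mulrBl.
under eq_bigr => h' _ do rewrite sumrB.
rewrite sumrB -(@big_bar_cons _ _ (fun t => (s == t)%:R * bar t (bar_cons h'' s''))).
rewrite (bigD1 s) //= eqxx mul1r big1 => [|t /negPf]; last first.
  by rewrite eq_sym => ->; rewrite mul0r.
rewrite (bigD1 h) //= [X in _ - (_ + X)]big1 => [|h' /negPf]; last first.
  by rewrite eq_sym => ->; rewrite big1 // => s' _; rewrite !mul0r.
rewrite !addr0 eqxx.
under [X in _ - X]eq_bigr => s' _ do rewrite mul1r bar_rec mulrBr mulrCA.
rewrite sumrB -big_distrr /= -/(kmul (D n.+1) (D n) s s'') IHn mulr0 subr0.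
rewrite (bigD1 (bar_cons h'' s'')) //= eqxx mulr1 big1 ?addr0 ?subrr //.
by move=> t /negPf ->; rewrite mulr0.
Qed.

Variable e : T.

(** As an operator on functions this substitutes [e] for the first entry; its
    transpose extends a function by zero off the tuples that start with [e]. *)
Definition bar_homotopy n : tup n -> tup n.+1 -> int :=
  fun s s' => (s' == bar_cons e s)%:R.

Local Notation P := bar_homotopy.

Lemma bar_contract0 : kmul (@P 0) (D 0) = kid.
Proof.
apply/funext => s; apply/funext => s'; rewrite kmul_deltal bar0 /kid.
by rewrite (_ : s == s' = true) //; apply/eqP/ffunP; case.
Qed.

Lemma bar_contract n s s' :
  kmul (D n) (@P n) s s' + kmul (@P n.+1) (D n.+1) s s' = kid s s'.
Proof.
rewrite kmul_deltal -(bar_consK s') bar_rec addrC addrAC -addrA.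
rewrite [X in _ + X](_ : _ = 0) ?addr0 //; apply/eqP; rewrite subr_eq0; apply/eqP.
rewrite /kmul; under eq_bigr do rewrite /P bar_cons_inj.
rewrite (bigD1 (bar_tail s')) //= eqxx andbT big1 ?addr0 => [|t /negPf].
  by rewrite mulrC eq_sym.
by rewrite eq_sym => ->; rewrite andbF mulr0.
Qed.

Lemma bar_contract0_tr : kmul (ktr (D 0)) (ktr (@P 0)) = kid.
Proof.
rewrite -(ktr_mul (@P 0) (D 0)) bar_contract0.
by apply/funext => s; apply/funext => s'; rewrite /ktr /kid eq_sym.
Qed.

Lemma bar_contract_tr n s s' :
  kmul (ktr (D n.+1)) (ktr (@P n.+1)) s s' + kmul (ktr (@P n)) (ktr (D n)) s s'
    = kid s s'.
Proof.
rewrite -(ktr_mul (D n) (@P n)) -(ktr_mul (@P n.+1) (D n.+1)) addrC /ktr.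
by rewrite bar_contract /kid eq_sym.
Qed.

End BarComplex.

(** * Equivariant functions and cochain operators *)

Section Equivariance.
Variables (R : comNzRingType) (gT : finGroupType) (H : {group gT}).
Local Notation sT := (subg_of H).
Local Notation L := (group_algebra R gT).

Definition translate n (h : sT) (s : {ffun 'I_n -> sT}) : {ffun 'I_n -> sT} :=
  [ffun i => (h * s i)%g].

Lemma translateK n h : cancel (@translate n h) (translate h^-1).
Proof. by move=> s; apply/ffunP => i; rewrite !ffunE mulKg. Qed.

Lemma translateVK n h : cancel (@translate n h^-1) (translate h).
Proof. by move=> s; apply/ffunP => i; rewrite !ffunE mulKVg. Qed.

Lemma translate_bij n h : bijective (@translate n h).
Proof. by exists (translate h^-1); [apply: translateK | apply: translateVK]. Qed.

(** Invariance under simultaneous left translation; such kernels preserve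
    equivariant functions. *)
Definition kernel_equiv m n (K : {ffun 'I_m -> sT} -> {ffun 'I_n -> sT} -> int) :=
  forall h s s', K (translate h s) (translate h s') = K s s'.

Lemma kernel_equiv_bar n : kernel_equiv (@bar sT n).
Proof.
move=> h s s'; apply: eq_bigr => i _; congr (_ * _%:R).
rewrite (_ : [ffun _ => _] = translate h [ffun j => s (lift i j)]).
  by rewrite (inj_eq (bij_inj (translate_bij n h))).
by apply/ffunP => j; rewrite !ffunE.
Qed.

Lemma kernel_equiv_tr m n (K : {ffun 'I_m -> sT} -> {ffun 'I_n -> sT} -> int) :
  kernel_equiv K -> kernel_equiv (ktr K).
Proof. by move=> eqK h s s'; apply: eqK. Qed.

Lemma ga_actM (V : lmodType L) h k (x : V) :
  ga_act (h * k)%g x = ga_act h (ga_act k x).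
Proof.
rewrite /ga_act scalerA; congr (_ *: _); apply/ffunP => l; rewrite !ffunE.
rewrite (bigD1 h) //= /ga_coef !ffunE eqxx mul1r big1 ?addr0 => [|i /negPf ih].
  by rewrite -(inj_eq (mulgI h^-1)%g l) mulKg.
by rewrite ffunE ih mul0r.
Qed.

Lemma kapp_equivariant (V : lmodType L) m n
    (K : {ffun 'I_m.+1 -> sT} -> {ffun 'I_n.+1 -> sT} -> int) (x : cochain V H n) :
  kernel_equiv K -> equivariant x -> equivariant (kapp K x : cochain V H m).
Proof.
move=> eqK eqx h s; rewrite -/(translate h s) /ga_act /kapp.
rewrite (reindex_onto (translate h) (translate h^-1)) /=; last first.
  by move=> t _; rewrite translateVK.
rewrite scaler_sumr; apply: eq_big => [t|t _]; first by rewrite translateK eqxx.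
by rewrite eqK eqx -scalerMzr.
Qed.

Variable V : lmodType L.

(** The norm map is written through the augmentation so that the homotopies of
    the two halves of the complex glue at degrees -1 and 0. *)
Definition bar_norm : {ffun 'I_1 -> sT} -> {ffun 'I_1 -> sT} -> int :=
  kmul (@bar sT 0) (ktr (@bar sT 0)).

Lemma bar_norm1 s s' : bar_norm s s' = 1.
Proof.
rewrite /bar_norm /kmul; under eq_bigr do rewrite /ktr !bar0 mulr1.
by rewrite sumr_const card_ffun card_ord expn0.
Qed.

Lemma signrZ (i : nat) (x : V) : (-1) ^+ i *: x = x *~ (-1) ^+ i.
Proof.
by rewrite -signr_odd -[in RHS]signr_odd; case: (odd i); rewrite ?expr0 ?expr1 ?scale1r // scaleN1r mulrN1z.
Qed.

Lemma d_posE n (x : cochain V H n) : d_pos x = kapp (@bar sT n.+1) x.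
Proof.
apply/funext => s; rewrite /d_pos /kapp /bar.
under [RHS]eq_bigr do rewrite mulrz_sumr.
rewrite exchange_big /=; apply: eq_bigr => i _.
rewrite (bigD1 (omit i s)) //= eqxx mulr1 big1 ?addr0 ?signrZ // => s' /negPf.
by rewrite eq_sym /omit => ->; rewrite mulr0 mulr0z.
Qed.

Lemma d_normE (x : cochain V H 0) : d_norm x = kapp bar_norm x.
Proof.
apply/funext => s; rewrite /d_norm /kapp.
under [RHS]eq_bigr do rewrite bar_norm1 mulr1z.
rewrite [RHS](reindex (fun t => [ffun=> t])) //=.
exists (fun s' : {ffun 'I_1 -> sT} => s' ord0) => [t _|s' _]; first by rewrite ffunE.
by apply/ffunP => i; rewrite ffunE (ord1 i).
Qed.

Lemma d_negE n (x : cochain V H n.+1) : d_neg x = kapp (ktr (@bar sT n.+1)) x.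
Proof.
apply/funext => s; rewrite /d_neg /kapp /ktr /bar exchange_big /=.
under [RHS]eq_bigr do rewrite mulrz_sumr.
rewrite [RHS]exchange_big /=; apply: eq_bigr => i _.
rewrite [RHS](bigID (fun s' => omit i s' == s)) /= [X in _ + X]big1 ?addr0; last first.
  by move=> s' /negPf; rewrite /omit => ->; rewrite mulr0 mulr0z.
rewrite (reindex_onto (fun t => insert i t s) (fun s' => s' i)) /=; last first.
  move=> s' /eqP <-; apply/ffunP => j; rewrite !ffunE.
  by case: unliftP => [k|] ->; rewrite ?ffunE.
apply: eq_big => [t|t _].
  rewrite ffunE unlift_none eqxx andbT; symmetry; apply/eqP/ffunP => j.
  by rewrite !ffunE liftK.
rewrite signrZ (_ : _ == _ = true) ?mulr1 //.
by apply/eqP/ffunP => j; rewrite !ffunE liftK.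
Qed.

End Equivariance.

(** * Cohomological triviality of L / uL *)

Section RegularQuotient.
Variables (R : comNzRingType) (gT : finGroupType).
Local Notation L := (group_algebra R gT).

Section Subgroup.
Variable H : {group gT}.
Local Notation sT := (subg_of H).
Local Notation tup n := {ffun 'I_n -> sT}.
Local Notation kernel m n := (tup m -> tup n -> int).

(** The projection of L, as a module over R, onto the span of a right
    transversal of [H]; its conjugates by [H] sum to the identity, so that L is
    relatively projective over [H]. *)
Definition restr_transversal (x : L) : L :=
  [ffun k => if repr (H :* k)%g == k then ga_coef x k else 0].

Fact restr_transversal_zmod_morphism : zmod_morphism restr_transversal.
Proof.
move=> x y; apply/ffunP => k; rewrite !ffunE /ga_coef; case: ifP; rewrite ?subr0 //.
by rewrite !ffunE.
Qed.

HB.instance Definition _ :=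
  GRing.isZmodMorphism.Build L L restr_transversal restr_transversal_zmod_morphism.

Lemma ga_coef_act h (x : L) k : ga_coef (ga_act h (x : L^o)) k = ga_coef x (h^-1 * k)%g.
Proof.
rewrite /ga_coef /ga_act ffunE (bigD1 h) //= /ga_coef ffunE eqxx mul1r.
by rewrite big1 ?addr0 // => i /negPf ih; rewrite ffunE ih mul0r.
Qed.

(** Each [k] is [h k'] for exactly one [h] in [H] and [k'] in the transversal, so
    exactly one summand contributes to the coefficient at [k]. *)
Lemma trace_restr_transversal (x : L) :
  \sum_(h : sT) ga_act (sgval h)
     (restr_transversal (ga_act (sgval h^-1) (x : L^o)) : L^o) = x.
Proof.
apply/ffunP => k; rewrite sum_ffunE.
have rkH : (k * (repr (H :* k))^-1)%g \in H.
  have /rcosetP[h Hh ->] := mem_repr_rcoset H k.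
  by rewrite invMg mulKVg groupV.
pose h0 : sT := subg H (k * (repr (H :* k))^-1)%g.
have h0K : ((sgval h0)^-1 * k = repr (H :* k))%g by rewrite subgK // invMg invgK mulgKV.
have coefE (h : sT) : ga_coef (ga_act (sgval h)
     (restr_transversal (ga_act (sgval h^-1) (x : L^o)) : L^o)) k =
   if (repr (H :* k) == (sgval h)^-1 * k)%g then x k else 0.
  rewrite ga_coef_act /ga_coef ffunE ga_coef_act.
  rewrite (_ : (H :* _ = H :* k)%g); last first.
    by rewrite rcosetM (rcoset_id (groupVr (subgP h))).
  rewrite (_ : ((sgval h^-1)^-1 * ((sgval h)^-1 * k) = k)%g) //.
  by rewrite -[sgval h^-1]/(sgval h)^-1%g invgK mulKVg.
rewrite (bigD1 h0) //= big1 ?addr0 => [|h /negPf hh0].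
  by rewrite -[LHS]/(ga_coef _ k) coefE h0K eqxx.
rewrite -[LHS]/(ga_coef _ k) coefE -h0K.
by rewrite (inj_eq (mulIg k)) (inj_eq invg_inj) (inj_eq subg_inj) eq_sym hh0.
Qed.

(** The vanishing of one Tate cohomology group, freed from the indexing of
    degrees by integers: the cocycle condition is [K1], coboundaries come from
    [K0]. *)
Definition exact_at (V : lmodType L) l m n (K0 : kernel m.+1 l.+1) (K1 : kernel n.+1 m.+1) :=
  forall x : cochain V H m, equivariant x -> kapp K1 x = (fun=> 0) ->
    exists2 y : cochain V H l, equivariant y & x = kapp K0 y.

(** A cocycle [x] equals [K0 z] with [z = S0 x], but [z] need not be
    equivariant. Restricting the values of [z] to a transversal and summing the
    translates over [H] repairs this and does not change the image under [K0],
    because [K0] is equivariant and [trace_restr_transversal] recovers [x]. *)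
Lemma exact_at_regular l m n (K0 : kernel m.+1 l.+1) (K1 : kernel n.+1 m.+1)
    (S0 : kernel l.+1 m.+1) (S1 : kernel m.+1 n.+1) :
    kernel_equiv K0 ->
    (forall s s', kmul K0 S0 s s' + kmul S1 K1 s s' = kid s s') ->
  exact_at L^o K0 K1.
Proof.
move=> eqK0 homotopy x eqx K1x.
pose z := kapp S0 x.
have zK : kapp K0 z = x.
  apply/funext => s; have := kapp_add (kmul K0 S0) (kmul S1 K1) x s.
  rewrite !kapp_mul K1x kapp0 addr0 => <-; rewrite -[RHS](congr1 (@^~ s) (kapp1 x)).
  by congr (kapp _ _ _); apply/funext => s1; apply/funext => s2; rewrite homotopy.
pose y : cochain L^o H l := fun s => \sum_(h : sT)
  ga_act (sgval h) (restr_transversal (z (translate h^-1 s)) : L^o).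
exists y.
  move=> h s; rewrite -/(translate h s) /y.
  rewrite (reindex_inj (mulgI h)) /= /ga_act scaler_sumr; apply: eq_bigr => k _.
  rewrite -!/(ga_act _ _) ga_actM; congr (@ga_act _ _ L^o _ (@ga_act _ _ L^o _ (restr_transversal (z _)))).
  by apply/ffunP => i; rewrite !ffunE invMg mulgA mulgKV.
apply/funext => s; rewrite -[LHS]trace_restr_transversal /y /kapp.
under [RHS]eq_bigr do rewrite mulrz_suml.
rewrite exchange_big /=; apply: eq_bigr => h _.
rewrite -[ga_act (sgval h)^-1 _](eqx h^-1%g s) -/(translate _ s) -zK.
rewrite /kapp raddf_sum /ga_act scaler_sumr /=.
rewrite (reindex_onto (translate h^-1) (translate h)) /=; last first.
  by move=> t _; rewrite translateK.
apply: eq_big => [t|t _]; first by rewrite translateVK eqxx.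
by rewrite eqK0 raddfMz scalerMzr.
Qed.

Section Shift.
Variables (V : lmodType L) (a : V) (u : L).
Hypothesis a_gen : mod_generator a.
Hypothesis u_central : forall c : L, c * u = u * c.
Hypothesis u_reg : forall c : L, u * c = 0 -> c = 0.
Hypothesis u_ann : forall c : L, c *: a = 0 <-> exists c', c = u * c'.

(** [H] acts freely on tuples, so a lift may be chosen freely on tuples that
    start with 1 and is then determined by translation. *)
Lemma equivariant_lift m (x : cochain V H m) : equivariant x ->
  exists2 x' : cochain L^o H m, equivariant x' & forall s, x s = (x' s : L) *: a.
Proof.
move=> eqx; have [sec secK] := choice a_gen.
exists (fun s : tup m.+1 => ga_act (sgval (s ord0)) (sec (x (translate (s ord0)^-1 s)) : L^o)).
  move=> h s; rewrite -/(translate h s) [translate h s ord0]ffunE -ga_actM.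
  congr (@ga_act _ _ L^o _ (sec (x _))).
  by apply/ffunP => i; rewrite !ffunE invMg mulgA mulgKV.
move=> s; rewrite /ga_act -scalerA -secK.
rewrite -[RHS]eqx; congr x.
by apply/ffunP => i; rewrite !ffunE mulKVg.
Qed.

(** Dimension shifting along 0 -> L -> L -> V -> 0, where the first map is
    multiplication by [u] and the second sends [c] to [c a]. A cocycle [x] lifts
    to [x'], and [K1 x' = u y]; as [u] is not a zero divisor, [y] is an
    equivariant cocycle, so [y = K1 v]. Now [x' - u v] is a cocycle with values
    in L that still lifts [x]. *)
Lemma exact_at_shift l m n k
    (K0 : kernel m.+1 l.+1) (K1 : kernel n.+1 m.+1) (K2 : kernel k.+1 n.+1) :
    kernel_equiv K1 -> kmul K2 K1 = (fun _ _ => 0) ->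
    exact_at L^o K0 K1 -> exact_at L^o K1 K2 ->
  exact_at V K0 K1.
Proof.
move=> eqK1 K21 ex01 ex12 x eqx K1x.
have [x' eqx' x'E] := equivariant_lift eqx.
have /choice[y yE] s : exists c, kapp K1 x' s = u * c.
  apply/u_ann; rewrite -[RHS](congr1 (@^~ s) K1x) /kapp scaler_suml.
  by apply: eq_bigr => t _; rewrite x'E scalerMzl.
have u_inj c c' : u * c = u * c' -> c = c'.
  by move/eqP; rewrite -subr_eq0 -mulrBr => /eqP/u_reg/eqP; rewrite subr_eq0 => /eqP.
have u_kapp m' n' (K : kernel m'.+1 n'.+1) (f : cochain L^o H n') s :
    u * kapp K f s = kapp K (fun t => u * f t) s.
  by rewrite /kapp mulr_sumr; apply: eq_bigr => t _; rewrite -mulrzAr.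
have eqy : equivariant (y : cochain L^o H n).
  move=> h s; apply: u_inj; rewrite -yE.
  rewrite (kapp_equivariant eqK1 eqx' h s) /ga_act yE.
  by rewrite -[LHS]/(gelt (sgval h) * (u * y s)) mulrA u_central -mulrA.
have K2y : kapp K2 (y : cochain L^o H n) = fun=> 0.
  apply/funext => s; apply: u_inj; rewrite u_kapp mulr0.
  rewrite (_ : (fun t => _) = kapp K1 x'); last by apply/funext => t; rewrite yE.
  by rewrite -kapp_mul K21 /kapp big1.
have [v eqv yv] := ex12 _ eqy K2y.
have [q eqq xq] : exists2 q : cochain L^o H l, equivariant q &
    (fun s => x' s - u * v s) = kapp K0 q.
  apply: ex01; last first.
    by apply/funext => s; rewrite kappB -u_kapp -yv yE subrr.
  move=> h s; rewrite eqx' eqv /ga_act scalerBr; congr (_ - _).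
  by rewrite -[RHS]/(_ * (u * v s)) mulrA u_central -mulrA.
exists (fun s => (q s : L) *: a).
  by move=> h s; rewrite eqq /ga_act scalerA.
apply/funext => s; rewrite x'E.
have uva : (u * v s) *: a = 0 by apply/u_ann; exists (v s).
rewrite -[LHS]subr0 -uva -scalerBl -[_ - _]/((fun s => x' s - u * v s) s) xq.
by rewrite /kapp scaler_suml; apply: eq_bigr => t _; rewrite scalerMzl.
Qed.

End Shift.

(** The homotopy across the norm map, adapted to its factorization through
    the augmentation. *)
Definition norm_homotopy (e : sT) : kernel 1 1 :=
  kmul (ktr (@bar_homotopy _ e 0)) (@bar_homotopy _ e 0).

Lemma exact_bar_regular n : exact_at L^o (@bar sT n.+1) (@bar sT n.+2).
Proof.
apply: (exact_at_regular (S0 := @bar_homotopy sT 1%g _) (S1 := @bar_homotopy sT 1%g _)).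
  exact: kernel_equiv_bar.
exact: bar_contract.
Qed.

Lemma exact_bar_tr_regular n : exact_at L^o (ktr (@bar sT n.+2)) (ktr (@bar sT n.+1)).
Proof.
apply: (exact_at_regular (S0 := ktr (@bar_homotopy sT 1%g _))
          (S1 := ktr (@bar_homotopy sT 1%g _))).
  exact/kernel_equiv_tr/kernel_equiv_bar.
exact: bar_contract_tr.
Qed.

Lemma kernel_equiv_norm : kernel_equiv (@bar_norm gT H).
Proof. by move=> h s s'; rewrite !bar_norm1. Qed.

Lemma exact_norm_bar_regular : exact_at L^o (@bar_norm gT H) (@bar sT 1).
Proof.
apply: (exact_at_regular (S0 := norm_homotopy 1%g)
          (S1 := @bar_homotopy sT 1%g _)) kernel_equiv_norm _.
move=> s s'; rewrite /norm_homotopy /bar_norm kmulA.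
rewrite -(kmulA (@bar sT 0) (ktr (@bar sT 0)) (ktr (@bar_homotopy sT 1%g 0))).
by rewrite bar_contract0_tr kmulr1 bar_contract.
Qed.

Lemma exact_bar_tr_norm_regular : exact_at L^o (ktr (@bar sT 1)) (@bar_norm gT H).
Proof.
apply: (exact_at_regular (S0 := ktr (@bar_homotopy sT 1%g _)) (S1 := norm_homotopy 1%g)).
  exact/kernel_equiv_tr/kernel_equiv_bar.
move=> s s'; rewrite /norm_homotopy /bar_norm kmulA.
rewrite -(kmulA (ktr (@bar_homotopy sT 1%g 0)) (@bar_homotopy sT 1%g 0) (@bar sT 0)).
by rewrite bar_contract0 kmulr1 bar_contract_tr.
Qed.

End Subgroup.

(** The differentials on both sides of degree [n] and the next one form three
    consecutive kernels; the five cases are n = 0, n > 0, n = -1, n = -2 and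
    n < -2, according to the position of the norm map. *)
Lemma cohomologically_trivial_regular_quotient (V : lmodType L) (a : V) (u : L) :
    mod_generator a -> (forall c : L, c * u = u * c) ->
    (forall c : L, u * c = 0 -> c = 0) ->
    (forall c : L, c *: a = 0 <-> exists c', c = u * c') ->
  cohomologically_trivial V.
Proof.
move=> a_gen u_central u_reg u_ann H.
have shift := exact_at_shift (H := H) a_gen u_central u_reg u_ann.
have barE := @kernel_equiv_bar gT H; have normE := @kernel_equiv_norm H.
have trE n : kernel_equiv (ktr (@bar (subg_of H) n)) := kernel_equiv_tr (barE n).
have dd n := @bar_bar (subg_of H) n.
have tt n : kmul (ktr (@bar (subg_of H) n)) (ktr (@bar (subg_of H) n.+1)) = fun _ _ => 0.
  by rewrite -(ktr_mul (@bar _ n.+1) (@bar _ n)) dd.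
case=> [[|m]|[|m]] x [eqx dx].
- have [|y eqy xy] := shift _ _ _ _ _ _ _ (barE _) (dd _) (@exact_norm_bar_regular H)
    (@exact_bar_regular H 0) x eqx.
    by rewrite -d_posE; apply/funext.
  by exists y => // s; rewrite xy d_normE.
- have [|y eqy xy] := shift _ _ _ _ _ _ _ (barE _) (dd _) (@exact_bar_regular H _)
    (@exact_bar_regular H _) x eqx.
    by rewrite -d_posE; apply/funext.
  by exists y => // s; rewrite xy d_posE.
- have [||y eqy xy] := shift _ _ _ _ _ _ (@bar _ _) normE _ (@exact_bar_tr_norm_regular H)
    (@exact_norm_bar_regular H) x eqx.
  + rewrite /bar_norm kmulA dd /kmul.
    by apply/funext => s; apply/funext => s'; rewrite big1 // => t _; rewrite mul0r.
  + by rewrite -d_normE; apply/funext.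
  by exists y => // s; rewrite xy d_negE.
case: m x eqx dx => [|m] x eqx dx.
- have [||y eqy xy] := shift _ _ _ _ _ _ (@bar_norm gT H) (trE _) _
    (@exact_bar_tr_regular H _) (@exact_bar_tr_norm_regular H) x eqx.
  + rewrite /bar_norm -kmulA tt /kmul.
    by apply/funext => s; apply/funext => s'; rewrite big1 // => t _; rewrite mulr0.
  + by rewrite -d_negE; apply/funext.
  by exists y => // s; rewrite xy d_negE.
- have [|y eqy xy] := shift _ _ _ _ _ _ _ (trE _) (tt _) (@exact_bar_tr_regular H _)
    (@exact_bar_tr_regular H _) x eqx.
    by rewrite -d_negE; apply/funext.
  by exists y => // s; rewrite xy d_negE.
Qed.

End RegularQuotient.

(** * Arithmetic of p-adic integers *)

Section PadicArith.
Variables (p : nat) (p_prime : prime p).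

Let p_gt1 : (1 < p)%N := prime_gt1 p_prime.
Let pX_gt1 n : (1 < p ^ n.+1)%N.
Proof. by rewrite -(exp1n n.+1) ltn_exp2r. Qed.

Lemma padic_modulus n : (Zp_trunc (p ^ n.+1)).+2 = (p ^ n.+1)%N.
Proof. by rewrite (Zp_cast (pX_gt1 n)). Qed.

Lemma val_inZp_pX k n : (inZp k : 'Z_(p ^ n.+1)) = (k %% p ^ n.+1)%N :> nat.
Proof. by rewrite /= padic_modulus. Qed.

Lemma padic_proj_nat m n : (m%:R : padic p) n = (m %% p ^ n.+1)%N :> nat.
Proof.
have -> : (m%:R : padic p) n = m%:R by elim: m => // m IHm; rewrite -!natr1 -IHm.
exact: val_Zp_nat (pX_gt1 n) m.
Qed.

Lemma padic_projD (x y : padic p) n : (x + y) n = ((x n + y n) %% p ^ n.+1)%N :> nat.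
Proof. by rewrite -[LHS]/((x n + y n) %% _)%N [X in (_ %% X)%N = _]padic_modulus. Qed.

Lemma padic_projM (x y : padic p) n : (x * y) n = ((x n * y n) %% p ^ n.+1)%N :> nat.
Proof. by rewrite -[LHS]/((x n * y n) %% _)%N [X in (_ %% X)%N = _]padic_modulus. Qed.

Lemma padic_proj_mod (x : padic p) n : x n = (x n.+1 %% p ^ n.+1)%N :> nat.
Proof. by rewrite -(padic_coh x n) /zp_red val_inZp_pX. Qed.

Lemma padic_proj_inj (x y : padic p) : (forall n, x n = y n :> nat) -> x = y.
Proof. by move=> exy; apply: padic_eqP => n; apply/val_inj/exy. Qed.

(** Only the component at level [n + 1] is divisible enough: p x = 0 modulo
    p^(n+2) gives x = 0 modulo p^(n+1). *)
Lemma padic_torsion_free (x : padic p) : x *+ p = 0 -> x = 0.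
Proof.
move=> px0; apply: padic_proj_inj => n.
have : (p ^ n.+1 * p %| x n.+1 * p)%N.
  have := congr1 (fun y : padic p => y n.+1 : nat) px0.
  rewrite -mulr_natr padic_projM padic_proj_nat modnMmr /dvdn => e.
  by rewrite -expnSr; apply/eqP.
by rewrite dvdn_pmul2r ?(ltnW p_gt1) // => /eqP e; rewrite padic_proj_mod e.
Qed.

(** The digit is the residue modulo [p]; the quotient is obtained at level [n]
    from the integer quotient of the representative at level [n + 1]. *)
Lemma padic_digit (x : padic p) : exists (m : nat) (y : padic p), x = m%:R + y *+ p.
Proof.
have yP n : zp_red (inZp (x n.+2 %/ p) : 'Z_(p ^ n.+2))
            = inZp (x n.+1 %/ p) :> 'Z_(p ^ n.+1).
  apply: ord_inj; rewrite /zp_red !val_inZp_pX.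
  rewrite [in RHS]padic_proj_mod modn_dvdm; last by rewrite padic_modulus dvdn_exp2l.
  by rewrite (expnSr p n.+1) -modn_divl modn_mod.
exists (x 0%N : nat); exists (@Padic p (fun n => inZp (x n.+1 %/ p)) yP).
apply: padic_proj_inj => n.
rewrite -[_ *+ p]mulr_natr padic_projD padic_projM !padic_proj_nat val_inZp_pX.
rewrite modnMml modnMmr modnDml modnDmr [LHS]padic_proj_mod.
have x0 : x 0%N = (x n.+1 %% p)%N :> nat.
  elim: n => [|n IHn]; first by rewrite padic_proj_mod expn1.
  by rewrite IHn [in LHS]padic_proj_mod modn_dvdm // dvdn_exp.
by rewrite x0 addnC -divn_eq.
Qed.

Lemma padic_digits n (x : padic p) :
  exists (m : nat) (y : padic p), x = m%:R + y *+ p ^ n.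
Proof.
elim: n => [|n [m [y ->]]]; first by exists 0%N; exists x; rewrite add0r.
have [k [z ->]] := padic_digit y; exists (m + k * p ^ n)%N; exists z.
by rewrite mulrnDl -[z *+ p *+ _]mulrnA -expnS addrA natrD natrM mulr_natr.
Qed.

Lemma padic_nat_unit m : coprime m p -> exists v : padic p, m%:R * v = 1.
Proof.
move=> co_mp.
have mU n : (m%:R : 'Z_(p ^ n.+1)) \is a GRing.unit.
  by rewrite unitZpE // coprime_sym coprimeXr.
have vP n : zp_red (m%:R^-1 : 'Z_(p ^ n.+2)) = m%:R^-1 :> 'Z_(p ^ n.+1).
  rewrite rmorphV; last exact: mU.
  by rewrite rmorph_nat.
exists (@Padic p (fun n => m%:R^-1) vP); apply: padic_eqP => n.
rewrite -[LHS]/((m%:R : padic p) n * m%:R^-1).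
have -> : (m%:R : padic p) n = m%:R.
  by apply/val_inj; rewrite /= padic_proj_nat val_Zp_nat.
exact: divrr (mU n).
Qed.

End PadicArith.

(** * The group algebra of a cyclic group *)

Section CyclicGroupAlgebra.
Variables (R : comNzRingType) (gT : finGroupType) (g : gT).
Hypothesis g_gen : <[g]>%g = [set: gT].
Local Notation L := (group_algebra R gT).
Local Notation gg := (gelt g : L).
Local Notation w := (gg - 1).

Lemma geltX n : gelt (g ^+ n)%g = gg ^+ n.
Proof.
elim: n => // n IHn; rewrite expgS exprS -IHn.
by have := ga_actM g (g ^+ n)%g (1 : L^o); rewrite /ga_act /= -![_ *: _]/(_ * _) !mulr1.
Qed.

Lemma gelt_cyclic (h : gT) : exists n, gelt h = gg ^+ n.
Proof.
have /cycleP[n ->] : h \in <[g]>%g by rewrite g_gen inE.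
by exists n; apply: geltX.
Qed.

Lemma ga_mulC (x y : L) : x * y = y * x.
Proof.
have gC (h k : gT) : (h * k = k * h)%g.
  have : h \in <[g]>%g by rewrite g_gen inE.
  have : k \in <[g]>%g by rewrite g_gen inE.
  by move=> /cycleP[i ->] /cycleP[j ->]; rewrite -!expgD addnC.
apply/ffunP => h; rewrite !ffunE [RHS](reindex_inj (inj_comp (mulgI h) invg_inj)) /=.
apply: eq_bigr => k _; rewrite mulrC; congr (_ * _); last by rewrite invMg invgK mulgKV.
by congr (ga_coef y _); rewrite gC.
Qed.

Lemma ga_basis (x : L) : x = \sum_h ga_coef x h *: gelt h.
Proof.
apply/ffunP => k; rewrite sum_ffunE (bigD1 k) //= !ffunE eqxx.
rewrite -[_ *: _]/(_ * _) mulr1 big1 ?addr0 // => h /negPf hk.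
by rewrite !ffunE eq_sym hk -[LHS]/(_ * _) mulr0.
Qed.

(** Every power of [g] is 1 modulo [w]. *)
Lemma ga_aug_decomp (c : L) : exists c0 c1, c = c0%:A + w * c1.
Proof.
have DP (c' d : L) : (exists c0 c1, c' = c0%:A + w * c1) ->
    (exists c0 c1, d = c0%:A + w * c1) -> exists c0 c1, c' + d = c0%:A + w * c1.
  move=> [c0 [c1 ->]] [d0 [d1 ->]]; exists (c0 + d0); exists (c1 + d1).
  by rewrite scalerDl mulrDr addrACA.
rewrite [c]ga_basis.
apply: (big_ind (fun d : L => exists c0 c1, d = c0%:A + w * c1)) => // [|h _].
  by exists 0; exists 0; rewrite scale0r mulr0 addr0.
have [n ->] := gelt_cyclic h; elim: n => [|n [c0 [c1 e]]].
  by exists (ga_coef c h); exists 0; rewrite mulr0 addr0.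
exists c0; exists (c1 + ga_coef c h *: gg ^+ n); rewrite mulrDr addrA -e.
by rewrite -scalerAr mulrBl mul1r scalerBr addrC subrK exprS.
Qed.

End CyclicGroupAlgebra.

Section PadicGroupAlgebra.
Variables (p : nat) (p_prime : prime p) (gT : finGroupType) (g : gT).
Hypothesis g_gen : <[g]>%g = [set: gT].
Hypothesis g_ord : #|gT| = p.
Local Notation L := (group_algebra (padic p) gT).
Local Notation gg := (gelt g : L).
Local Notation w := (gg - 1).

Lemma ga_torsion_free (x : L) : x *+ p = 0 -> x = 0.
Proof.
move=> px0; apply/ffunP => h; rewrite ffunE; apply: (padic_torsion_free p_prime).
by have := congr1 (fun y : L => y h) px0; rewrite ffunMnE ffunE.
Qed.

(** L/(w) is Z_p, and Z_p/(p^n) is represented by the numbers below [p^n]. *)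
Lemma ga_digits n (c : L) :
  exists (i : 'I_(p ^ n)) (c1 c2 : L), c = i%:R + c1 * w + c2 *+ p ^ n.
Proof.
have [c0 [c1 ->]] := ga_aug_decomp g_gen c.
have [m [y ->]] := padic_digits p_prime n c0.
have pn_gt0 : (0 < p ^ n)%N by rewrite expn_gt0 prime_gt0.
exists (Ordinal (ltn_pmod m pn_gt0)); exists c1; exists (y%:A + (m %/ p ^ n)%:R).
have mE : m%:R = (m %% p ^ n)%:R + (m %/ p ^ n)%:R *+ p ^ n :> L.
  by rewrite {1}(divn_eq m (p ^ n)) natrD natrM mulr_natr addrC.
rewrite /= scalerDl scaler_nat mE -scalerMnl mulrnDl (ga_mulC g_gen w) -!addrA.
by congr (_ + _); rewrite addrA addrC [_ + y%:A *+ _]addrC.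
Qed.

Lemma gelt_order : gg ^+ p = 1.
Proof.
by rewrite -geltX -g_ord -cardsT -g_gen -[#|_|]/#[g]%g expg_order.
Qed.

Definition ga_norm : L := \sum_(i < p) gg ^+ i.

Lemma order_g : #[g]%g = p.
Proof. by rewrite -g_ord -cardsT -g_gen. Qed.

Lemma ga_norm_sum : ga_norm = \sum_h gelt h.
Proof.
rewrite (reindex (fun i : 'I_p => g ^+ i)%g) /=; last first.
  apply: onW_bij; apply: inj_card_bij; last by rewrite card_ord g_ord.
  move=> i j /eqP; rewrite eq_expg_mod_order order_g !modn_small ?ltn_ord // => /eqP.
  exact: ord_inj.
by apply: eq_bigr => i _; rewrite geltX.
Qed.

Lemma ga_norm_aug : w * ga_norm = 0.
Proof. by rewrite -subrX1 gelt_order subrr. Qed.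

Lemma ga_aug_norm : ga_norm * w = 0.
Proof. by rewrite (ga_mulC g_gen) ga_norm_aug. Qed.

Lemma ga_norm_modw : exists c, ga_norm = p%:R + w * c.
Proof.
have gX i : exists c, gg ^+ i = 1 + w * c.
  elim: i => [|i [c e]]; first by exists 0; rewrite mulr0 addr0.
  by exists (c + gg ^+ i); rewrite mulrDr addrA -e mulrBl mul1r addrC subrK exprS.
have /choice[f fE] := gX; exists (\sum_(i < p) f i).
rewrite /ga_norm; under eq_bigr do rewrite fE.
by rewrite big_split /= sumr_const card_ord mulr_sumr.
Qed.

(** The action of Z_p[zeta], as an element of L. It is multiplicative only up
    to multiples of the norm element, hence after multiplication by [w]. *)
Definition cyclo_eval (x : cyclo_int p) : L := horner_alg gg (polyn x).

Lemma cyclo_eval_in_qpoly (q : {poly padic p}) :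
  w * cyclo_eval (in_qpoly (cyclo_poly p) q) = w * horner_alg gg q.
Proof.
have -> : horner_alg gg q =
    horner_alg gg (Pdiv.CommonRing.rdivp q (mk_monic (cyclo_poly p))) * ga_norm
    + cyclo_eval (in_qpoly (cyclo_poly p) q).
  rewrite {1}[q](Pdiv.RingMonic.rdivp_eq (monic_mk_monic (cyclo_poly p))).
  rewrite rmorphD rmorphM; congr (_ * _ + _).
  rewrite mk_monic_cyclo_poly // /cyclo_poly rmorph_sum.
  by apply: eq_bigr => i _; rewrite rmorphXn /= horner_algX.
by rewrite mulrDr mulrA -(ga_mulC g_gen ga_norm) mulrA ga_aug_norm mul0r add0r.
Qed.

Lemma cyclo_evalM x y : w * cyclo_eval (x * y) = w * cyclo_eval x * cyclo_eval y.
Proof.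
have := cyclo_eval_in_qpoly (polyn x * polyn y).
by rewrite (rmorphM (horner_alg gg) (polyn x) (polyn y)) mulrA.
Qed.

Lemma cyclo_evalD x y : cyclo_eval (x + y) = cyclo_eval x + cyclo_eval y.
Proof. exact: (rmorphD (horner_alg gg) (polyn x) (polyn y)). Qed.

Lemma cyclo_eval_nat n : cyclo_eval n%:R = n%:R.
Proof. by rewrite /cyclo_eval qpolyC_natr rmorph_nat. Qed.

Lemma cyclo_eval_zeta : w * cyclo_eval (zeta p - 1) = w ^+ 2.
Proof.
have -> : zeta p - 1 = in_qpoly (cyclo_poly p) ('X - 1).
  rewrite [RHS](rmorphB (in_qpoly (cyclo_poly p))); congr (_ - _).
  exact/esym/in_qpoly1.
by rewrite (cyclo_eval_in_qpoly ('X - 1)) (rmorphB (horner_alg gg)) rmorph1 /= horner_algX.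
Qed.

Lemma cyclo_evalX x n : w * cyclo_eval (x ^+ n) = w * cyclo_eval x ^+ n.
Proof.
elim: n => [|n IHn]; first by rewrite !expr0 (cyclo_eval_nat 1).
by rewrite exprSr cyclo_evalM IHn -mulrA -exprSr.
Qed.

Lemma cyclo_eval_zetaX n : w * cyclo_eval ((zeta p - 1) ^+ n) = w ^+ n.+1.
Proof.
rewrite cyclo_evalX; elim: n => [|n IHn]; first by rewrite mulr1.
by rewrite exprSr mulrA IHn exprSr -mulrA cyclo_eval_zeta -exprD addn2.
Qed.

Lemma cyclo_evalM_zetaX x m :
  w * cyclo_eval (x * (zeta p - 1) ^+ m) = w * (cyclo_eval x * w ^+ m).
Proof.
rewrite cyclo_evalM (ga_mulC g_gen w) -mulrA cyclo_eval_zetaX exprS mulrA.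
by rewrite (ga_mulC g_gen _ w) -mulrA.
Qed.

Lemma cyclo_eval_eps eps s m n k :
  w * cyclo_eval (eps ^+ s * (zeta p - 1) ^+ m + n%:R * (zeta p - 1) ^+ k)
    = w * (cyclo_eval eps ^+ s * w ^+ m + n%:R * w ^+ k).
Proof.
rewrite cyclo_evalD !mulrDr; congr (_ + _).
  by rewrite cyclo_evalM_zetaX !mulrA (cyclo_evalX eps).
by rewrite cyclo_evalM_zetaX (cyclo_eval_nat n).
Qed.

Variable eps : cyclo_int p.
Hypothesis epsP : is_eps eps.
Local Notation E := (cyclo_eval eps).

(** The relation between [p] and the uniformizer of Z_p[zeta], on the
    augmentation ideal. *)
Lemma aug_p : w *+ p = E * w ^+ p.
Proof.
have [_ e] := epsP; rewrite -mulr_natr -cyclo_eval_nat e cyclo_evalM_zetaX.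
by rewrite mulrA (ga_mulC g_gen w) -mulrA -exprS prednK // prime_gt0.
Qed.

Lemma aug_eps_unit : exists E', E' * E * w = w.
Proof.
have [[eps' e] _] := epsP; exists (cyclo_eval eps').
have := cyclo_evalM eps' eps; rewrite mulrC e (cyclo_eval_nat 1) mulr1 => w1.
by rewrite -(ga_mulC g_gen w) mulrA -w1.
Qed.

Lemma aug_pX k : w *+ (p ^ k) = E ^+ k * w ^+ (k * p.-1).+1.
Proof.
elim: k => [|k IHk]; first by rewrite mul1r.
rewrite expnSr mulrnA IHk [w ^+ (k * _).+1]exprSr -!mulrnAr aug_p exprS.
rewrite !mulrA -(mulrA (E ^+ k)) (ga_mulC g_gen (w ^+ _) E) -!mulrA -exprD !mulrA.
rewrite -exprS exprSr; congr (_ * _ ^+ _).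
by rewrite mulSn; case: p p_prime => [|n] //= _; rewrite addnS addnC.
Qed.

Lemma aug_X_p k : exists c, w ^+ (k * p.-1).+1 = c *+ p ^ k.
Proof.
have [E' E'E] := aug_eps_unit; exists (E' ^+ k * w).
rewrite -mulrnAr aug_pX mulrA exprS mulrA; congr (_ * _).
elim: k => [|k IHk]; first by rewrite !mul1r.
rewrite [E ^+ k.+1]exprS [E' ^+ k.+1]exprSr mulrA -[_ * E' * E]mulrA -!mulrA.
by rewrite (ga_mulC g_gen _ w) 2![X in _ ^+ k * X]mulrA E'E (ga_mulC g_gen w) mulrA -IHk.
Qed.

(** The residue field of Z_p[zeta] has [p] elements, and [w] generates the
    augmentation ideal, a free Z_p[zeta]-module of rank 1. *)
Lemma aug_digit (c : L) : exists (i : 'I_p) c', c * w = w *+ i + c' * w ^+ 2.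
Proof.
have [i [c1 [c2 ->]]] := ga_digits 1 c.
have i_lt : (i < p)%N by rewrite -[X in (_ < X)%N]expn1.
exists (Ordinal i_lt); exists (c1 + c2 * E * w ^+ p.-2).
have wp : w ^+ p = w ^+ p.-2 * w ^+ 2.
  by rewrite -exprD addn2; congr (_ ^+ _); case: p p_prime => [|[|n]].
rewrite [X in c2 *+ X]expn1 !mulrDl addrA mulr_natl -[c1 * w * w]mulrA -expr2.
congr (_ + _ + _).
by rewrite mulrnAl -mulrnAr aug_p wp !mulrA.
Qed.

(** From [w^2 x = 0] follows [p w x = E w^p x = 0], as [p >= 2], and L has no
    torsion. *)
Lemma aug_sq_reg (x : L) : w ^+ 2 * x = 0 -> w * x = 0.
Proof.
move=> w2x; apply: ga_torsion_free; rewrite -mulrnAl aug_p.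
have e : p = (p.-2 + 2)%N by case: p p_prime => [|[|n]] //; rewrite addn2.
transitivity (E * w ^+ p.-2 * (w ^+ 2 * x)); last by rewrite w2x mulr0.
by rewrite [X in w ^+ X]e exprD !mulrA.
Qed.

(** The difference of both sides is a multiple of [w], as both are [p] modulo
    [w], and it is killed by [w]; such an element vanishes by [aug_sq_reg]. *)
Lemma ga_normE : ga_norm = p%:R - E * w ^+ p.-1.
Proof.
have p_gt1 := prime_gt1 p_prime.
have [c Nc] := ga_norm_modw.
have wX : w ^+ p.-1 = w * w ^+ p.-2 by rewrite -exprS; case: p p_gt1 => [|[|]].
have NE : w * (c + E * w ^+ p.-2) = ga_norm - p%:R + E * w ^+ p.-1.
  rewrite mulrDr wX [w * (E * _)]mulrA (ga_mulC g_gen w E) -[E * w * _]mulrA.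
  by rewrite Nc [p%:R + _]addrC addrK.
have : w * (c + E * w ^+ p.-2) = 0.
  apply: aug_sq_reg; rewrite expr2 -mulrA NE mulrDr mulrBr ga_norm_aug sub0r.
  rewrite mulr_natr aug_p mulrA (ga_mulC g_gen w E) -mulrA -exprS prednK ?addNr //.
  exact: ltnW.
rewrite NE => /eqP; rewrite addr_eq0 => /eqP e.
by rewrite -[LHS](subrK p%:R) e addrC.
Qed.

End PadicGroupAlgebra.

(** * Finite modules over the group algebra *)

Lemma card_direct (A : finZmodType) (T : finType) (S : {set T}) (f : T -> A)
    (B C : {set A}) :
    (forall x y, x \in B -> y \in B -> x - y \in B) ->
    (forall x, reflect (exists2 i, i \in S & exists2 y, y \in B & x = f i + y) (x \in C)) ->
    {in S &, forall i j, f i - f j \in B -> i = j} ->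
  #|C| = (#|S| * #|B|)%N.
Proof.
move=> subB CP f_inj; rewrite -cardsX.
have <- : [set f q.1 + q.2 | q in setX S B] = C.
  apply/setP => x; apply/imsetP/CP => [[[i y]]|[i Si [y By ->]]].
    by case/setXP => Si By ->; exists i => //; exists y.
  by exists (i, y) => //; apply/setXP.
apply: card_in_imset => -[i y] [j z] /setXP[/= Si By] /setXP[/= Sj Bz] e.
have ij : i = j.
  apply: f_inj => //; rewrite (_ : _ - _ = z - y) ?subB //.
  by apply/eqP; rewrite subr_eq addrAC [z + _]addrC -e addrK.
by move: e; rewrite ij => /addrI ->.
Qed.

(** The counting step for a filtration with cyclic layers: [n] is the order of
    [x] modulo [B]. *)
Lemma card_multiples_direct (A : finZmodType) (x : A) n (B C : {set A}) :
    0 \in B -> (forall y z, y \in B -> z \in B -> y - z \in B) ->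
    (forall y, reflect (exists i : 'I_n, exists2 z, z \in B & y = x *+ i + z) (y \in C)) ->
    (forall k, (k < n)%N -> x *+ k \in B -> k = 0%N) ->
  #|C| = (n * #|B|)%N.
Proof.
move=> B0 subB CP xB.
have -> : (n * #|B| = #|[set: 'I_n]| * #|B|)%N by rewrite cardsT card_ord.
have wlog_inj (i j : 'I_n) : (i <= j)%N -> x *+ j - x *+ i \in B -> i = j.
  move=> ij; rewrite -mulrnBr // => /xB ji; apply/ord_inj/eqP.
  by rewrite eqn_leq ij -subn_eq0 ji // (leq_ltn_trans (leq_subr _ _)).
apply: (card_direct (f := fun i : 'I_n => x *+ i)) => // [y|i j _ _ ijB].
  apply: (iffP (CP y)) => [[i [z zB ->]]|[i _ [z zB ->]]]; last by exists i; exists z.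
  by exists i => //; exists z.
case: (leqP i j) => [ij|/ltnW ji]; last exact/esym/wlog_inj.
by apply: wlog_inj => //; rewrite -opprB -[X in X \in _]sub0r subB.
Qed.

(** Translation by [x] permutes the elements, so their sum does not change. *)
Lemma mulrn_card (A : finZmodType) (x : A) : x *+ #|A| = 0.
Proof.
have e : \sum_(y : A) y = \sum_(y : A) y + x *+ #|A|.
  by rewrite {1}(reindex_inj (addIr x)) /= big_split /= sumr_const.
by apply/eqP; rewrite -(inj_eq (addrI (\sum_(y : A) y))) -e addr0.
Qed.

Section FiniteModule.
Variables (p : nat) (p_prime : prime p) (gT : finGroupType) (g : gT).
Hypothesis g_gen : <[g]>%g = [set: gT].
Hypothesis g_ord : #|gT| = p.
Local Notation L := (group_algebra (padic p) gT).
Local Notation gg := (gelt g : L).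
Local Notation w := (gg - 1).
Variable eps : cyclo_int p.
Hypothesis epsP : is_eps eps.
Local Notation E := (cyclo_eval g eps).
Variable A : finLmodType L.

Lemma ga_scaleC (c d : L) (x : A) : c *: (d *: x) = d *: (c *: x).
Proof. by rewrite !scalerA (ga_mulC g_gen). Qed.

Lemma module_nat_unit m : coprime m p -> exists c : L, forall x : A, c *: (x *+ m) = x.
Proof.
move=> /(padic_nat_unit p_prime)[v mv]; exists v%:A => x.
by rewrite -scaler_nat scalerA mulr_natr scalerMnl -mulr_natl mv !scale1r.
Qed.

(** The part of the order of [A] prime to [p] acts invertibly. *)
Lemma module_p_torsion : exists k, forall x : A, x *+ p ^ k = 0.
Proof.
have A_gt0 : (0 < #|A|)%N by apply/card_gt0P; exists 0.
have [m co_pm cardA] := pfactor_coprime p_prime A_gt0.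
have [c cm] := module_nat_unit (etrans (coprime_sym _ _) co_pm).
exists (logn p #|A|) => x; rewrite -[LHS]cm -mulrnA mulnC -cardA mulrn_card.
exact: scaler0.
Qed.

Lemma module_w_nilpotent : exists k, forall x : A, w ^+ k *: x = 0.
Proof.
have [k pk] := module_p_torsion.
have [c wc] := aug_X_p p_prime g_gen g_ord epsP k.
by exists (k * p.-1).+1 => x; rewrite wc -scalerMnl pk.
Qed.

(** The equation iterates to [x = c^n w^n x], and [w] is nilpotent. *)
Lemma w_nakayama (x : A) c : x = c *: (w *: x) -> x = 0.
Proof.
move=> xE; have [k wk] := module_w_nilpotent.
suff e n : x = c ^+ n *: (w ^+ n *: x) by rewrite (e k) wk scaler0.
elim: n => [|n IHn]; first by rewrite !scale1r.
rewrite {1}IHn {1}xE (ga_scaleC _ c) scalerA -exprSr; congr (_ *: _).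
by rewrite scalerA -exprSr.
Qed.

Lemma p_nakayama (x : A) c : x = c *: (x *+ p) -> x = 0.
Proof.
move=> xE; have [k pk] := module_p_torsion.
suff e n : x = c ^+ n *: (x *+ p ^ n) by rewrite (e k) pk scaler0.
elim: n => [|n IHn]; first by rewrite scale1r.
by rewrite {1}IHn {1}xE scalerMnr scalerA -exprSr -mulrnA -expnS.
Qed.

(** A nonzero digit is a unit, so that [x] would be a multiple of [w x]. *)
Lemma w_digit_eq0 (x : A) (i : nat) c : (i < p)%N ->
  x *+ i = c *: (w *: x) -> x != 0 -> i = 0%N.
Proof.
case: i => // i i_lt e; case/eqP; have co : coprime i.+1 p.
  by rewrite coprime_sym prime_coprime // gtnNdvd.
have [d dE] := module_nat_unit co; apply: (@w_nakayama _ (d * c)).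
by rewrite -scalerA -e dE.
Qed.

Definition cyclic_set (v : A) : {set A} := [set x | `[< exists c : L, x = c *: v >]].

Lemma cyclic_setP v x : reflect (exists c : L, x = c *: v) (x \in cyclic_set v).
Proof. by rewrite inE; apply: asboolP. Qed.

Lemma cyclic_setB v x y :
  x \in cyclic_set v -> y \in cyclic_set v -> x - y \in cyclic_set v.
Proof.
by move=> /cyclic_setP[c ->] /cyclic_setP[d ->]; apply/cyclic_setP; exists (c - d);
  rewrite scalerBl.
Qed.

(** Each step of the filtration by powers of [w] has index [p], the cosets
    being given by the digits. *)
Lemma card_cyclic_set r (v : A) :
    w ^+ r *: (w *: v) = 0 ->
    (forall j, (j < r)%N -> w ^+ j *: (w *: v) != 0) ->
  #|cyclic_set (w *: v)| = (p ^ r)%N.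
Proof.
elim: r v => [|r IHr] v wr0 wj.
  rewrite scale1r in wr0; rewrite wr0 -[RHS](cards1 (0 : A)); apply: eq_card => x.
  rewrite inE; apply/cyclic_setP/eqP => [[c ->]|->]; first by rewrite scaler0.
  by exists 0; rewrite scaler0.
have cardB : #|cyclic_set (w *: (w *: v))| = (p ^ r)%N.
  by apply: IHr => [|j jr]; rewrite scalerA -exprSr ?wr0 // wj.
rewrite expnS -cardB; apply: (card_multiples_direct (x := w *: v)).
- by apply/cyclic_setP; exists 0; rewrite scale0r.
- exact: cyclic_setB.
- move=> x; apply: (iffP (cyclic_setP _ _)) => [[c ->]|[i [y /cyclic_setP[c ->] ->]]].
    have [i [c' e]] := aug_digit p_prime g_gen g_ord epsP c; exists i.
    exists (c' *: (w *: (w *: v))); first by apply/cyclic_setP; exists c'.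
    by rewrite scalerA e scalerDl -scalerMnl !scalerA expr2 mulrA.
  by exists (i%:R + c * w); rewrite [RHS]scalerDl scaler_nat !scalerA.
move=> k k_lt /cyclic_setP[c e]; apply: (w_digit_eq0 k_lt e).
by have := wj 0%N isT; rewrite scale1r.
Qed.

Variable a : A.
Hypothesis a_gen : mod_generator a.

Lemma ann_generator (c : L) : c *: a = 0 -> forall x : A, c *: x = 0.
Proof. by move=> ca x; have [d ->] := a_gen x; rewrite ga_scaleC ca scaler0. Qed.

Lemma aug_imageE : aug_image g A = cyclic_set (w *: a).
Proof.
apply/setP => x; apply/imsetP/cyclic_setP => [[y _ ->]|[c ->]].
  by have [c ->] := a_gen y; exists c; rewrite ga_scaleC.
by exists (c *: a) => //; rewrite ga_scaleC.
Qed.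

Lemma inv_rP : w ^+ inv_r g A *: (w *: a) = 0 /\
  forall j, (j < inv_r g A)%N -> w ^+ j *: (w *: a) != 0.
Proof.
have ex_r : exists n, w ^+ n *: (w *: a) == 0.
  by have [k wk] := module_w_nilpotent; exists k; rewrite wk.
case: (ex_minnP ex_r) => r /eqP wr0 r_min.
have wj j : (j < r)%N -> w ^+ j *: (w *: a) != 0.
  by move=> jr; apply/negP => /r_min; rewrite leqNgt jr.
by rewrite /inv_r aug_imageE (card_cyclic_set wr0 wj) pfactorK.
Qed.

Lemma card_aug_image : #|aug_image g A| = (p ^ inv_r g A)%N.
Proof. by have [w0 wj] := inv_rP; rewrite aug_imageE (card_cyclic_set w0 wj). Qed.

Lemma fixed_pointsE : fixed_points A = [set x | w *: x == 0].
Proof.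
apply/setP => x; rewrite !inE; apply/forallP/eqP => [fx|wx h].
  by rewrite scalerBl scale1r; apply/eqP; rewrite subr_eq0; apply: fx.
have [n hE] := gelt_cyclic (padic p) g_gen h; rewrite /ga_act hE.
have gx : gg *: x = x by apply/eqP; rewrite -subr_eq0 -[X in _ - X]scale1r -scalerBl wx.
by apply/eqP; elim: n {hE} => [|n IHn]; rewrite ?scale1r // exprS -scalerA IHn.
Qed.

(** Multiplication by [w] has image [w A] and kernel the fixed points. *)
Lemma card_aug_fixed : #|A| = (#|aug_image g A| * #|fixed_points A|)%N.
Proof.
have /choice[sec secE] (y : A) : exists x : A, y \in aug_image g A -> y = w *: x.
  case: (boolP (y \in aug_image g A)) => [/imsetP[x _ ->]|_]; first by exists x.
  by exists 0.
rewrite -cardsT; apply: (card_direct (f := sec)).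
- by move=> x y; rewrite fixed_pointsE !inE scalerBr => /eqP-> /eqP->; rewrite subrr.
- move=> x; apply: (iffP idP) => _; last by rewrite inE.
  exists (w *: x); first by apply/imsetP; exists x.
  exists (x - sec (w *: x)); last by rewrite addrC subrK.
  by rewrite fixed_pointsE inE scalerBr -secE ?subrr //; apply/imsetP; exists x.
move=> y z yB zB; rewrite fixed_pointsE inE scalerBr -!secE // subr_eq0.
by move/eqP.
Qed.

(** By [card_aug_fixed] the group of fixed points has the order of A/wA,
    which is cyclic and generated by the class of [a]. *)
Lemma inv_sP : [/\ #|fixed_points A| = (p ^ inv_s A)%N,
    exists c, a *+ p ^ inv_s A = c *: (w *: a)
  & forall n, (exists c, a *+ n = c *: (w *: a)) -> (p ^ inv_s A %| n)%N].
Proof.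
have ex_s : exists n, `[< exists c, a *+ p ^ n = c *: (w *: a) >].
  by have [k pk] := module_p_torsion; exists k; apply/asboolP; exists 0; rewrite pk scale0r.
case: (ex_minnP ex_s) => s /asboolP ps s_min.
have s_dvd n : (exists c, a *+ n = c *: (w *: a)) -> (p ^ s %| n)%N.
  case=> c e; have [->|n_gt0] := posnP n; first by rewrite dvdn0.
  have [m co_pm nE] := pfactor_coprime p_prime n_gt0.
  rewrite nE dvdn_mull // dvdn_exp2l // s_min //; apply/asboolP.
  have [d dm] := module_nat_unit (etrans (coprime_sym _ _) co_pm).
  by exists (d * c); rewrite -scalerA -e [in RHS]nE mulnC mulrnA dm.
have cardA : #|A| = (p ^ s * #|aug_image g A|)%N.
  rewrite -cardsT aug_imageE; apply: (card_multiples_direct (x := a)).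
  - by apply/cyclic_setP; exists 0; rewrite scale0r.
  - exact: cyclic_setB.
  - move=> x; apply: (iffP idP) => _; last by rewrite inE.
    have [c ->] := a_gen x.
    have [i [c1 [c2 ->]]] := ga_digits p_prime g_gen s c; exists i.
    have [d dE] := ps; exists ((c1 + c2 * d) *: (w *: a)).
      by apply/cyclic_setP; exists (c1 + c2 * d).
    rewrite 2![in LHS]scalerDl scaler_nat -addrA; congr (_ + _).
    rewrite [RHS]scalerDl; congr (_ + _); first by rewrite scalerA.
    by rewrite -scalerA -dE -scalerMnl scalerMnr.
  move=> k k_lt /cyclic_setP kB; have /s_dvd := kB.
  by case: (posnP k) => // k_gt0; rewrite gtnNdvd.
have /eqP := etrans (esym cardA) card_aug_fixed.
rewrite mulnC eqn_pmul2l; last by rewrite card_aug_image expn_gt0 prime_gt0.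
move/eqP => e; have -> : inv_s A = s by rewrite /inv_s -e pfactorK.
by split.
Qed.

(** As long as [w^(q + j) w a] is not zero, the digit of [c w] at [w^(j+1)] must
    vanish, so [c w] can be divided by one more power of [w]. *)
Lemma aug_lift q j c : (q + j <= inv_r g A)%N ->
  w ^+ q *: (c *: (w *: a)) = 0 -> exists c', c * w = c' * w ^+ j.+1.
Proof.
have [_ wj] := inv_rP => qj cw0; elim: j qj => [|j IHj] qj; first by exists c.
have [|c1 cE] := IHj; first by rewrite (leq_trans _ qj) // leq_add2l.
have [i [c2 c1E]] := aug_digit p_prime g_gen g_ord epsP c1.
have cwE : c * w = w ^+ j.+1 *+ i + c2 * w ^+ j.+2.
  rewrite cE exprS mulrA c1E mulrDl; congr (_ + _); first by rewrite mulrnAl.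
  by rewrite -[LHS]mulrA -exprD add2n.
suff i0 : val i = 0%N by exists c2; rewrite cwE [X in _ *+ X]i0 mulr0n add0r.
apply: (w_digit_eq0 (x := w ^+ (q + j) *: (w *: a)) (c := - c2) (ltn_ord i)); last first.
  by apply: wj; rewrite -addnS.
apply/eqP; rewrite scaleNr -addr_eq0; apply/eqP.
rewrite -[RHS]cw0 [c *: _]scalerA cwE [X in w ^+ q *: X]scalerDl [RHS]scalerDr; congr (_ + _).
  by rewrite -scalerMnl -scalerMnr !scalerA -exprSr -exprD addnS.
by rewrite -[(c2 * _) *: a]scalerA [RHS]ga_scaleC; congr (_ *: _);
  rewrite !scalerA -exprD -exprS -exprSr !addnS.
Qed.

Lemma ann_aug c : c *: (w *: a) = 0 -> exists c', c * w = c' * w ^+ (inv_r g A).+1.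
Proof. by move=> c0; apply: (@aug_lift 0); rewrite ?add0n // scale1r. Qed.

(** The fixed points in [w A] form the last nonzero step of its filtration. *)
Lemma fixed_aug c : (0 < inv_r g A)%N -> w *: (c *: (w *: a)) = 0 ->
  exists i : 'I_p, c *: (w *: a) = (w ^+ inv_r g A *: a) *+ i.
Proof.
move=> r_gt0 cw0; have [|c1 cE] := @aug_lift 1 (inv_r g A).-1 c _ cw0.
  by rewrite add1n prednK.
rewrite prednK // in cE.
have [i [c2 c1E]] := aug_digit p_prime g_gen g_ord epsP c1; exists i.
have [wr0 _] := inv_rP.
have wX : w ^+ inv_r g A = w * w ^+ (inv_r g A).-1 by rewrite -exprS prednK.
rewrite scalerA cE {1}wX mulrA c1E mulrDl [LHS]scalerDl.
rewrite [X in _ + X](_ : _ = 0) ?addr0; first by rewrite mulrnAl -wX -scalerMnl.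
by rewrite -mulrA -exprD add2n prednK // -scalerA exprSr -scalerA wr0 scaler0.
Qed.

Lemma is_inv_tE t : (0 < inv_r g A)%N -> (0 < inv_s A)%N ->
  is_inv_t g eps a t <->
  a *+ p ^ inv_s A = (E ^+ inv_s A * w ^+ (inv_s A * p.-1)
                      + (t : nat)%:R * w ^+ inv_r g A) *: a.
Proof.
move=> r_gt0 s_gt0; rewrite /is_inv_t /cyclo_act.
have sp_gt0 : (0 < inv_s A * p.-1)%N.
  by rewrite muln_gt0 s_gt0 -ltnS prednK ?prime_gt1 ?prime_gt0.
rewrite scalerA -(ga_mulC g_gen w) (cyclo_eval_eps p_prime g_gen g_ord).
rewrite mulrDr 2![w * (_ * _)]mulrA -2![w * _](ga_mulC g_gen) -!mulrA -!exprS.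
by rewrite !prednK.
Qed.

(** Multiplying by [w] turns p^s a into p^s w a = E^s w^(s(p-1)) w a, so the
    difference of p^s a and E^s w^(s(p-1)) a is fixed by [G]. *)
Lemma inv_t_exists : (0 < inv_r g A)%N -> (0 < inv_s A)%N ->
  exists t, is_inv_t g eps a t.
Proof.
move=> r_gt0 s_gt0; have [_ [c cE] _] := inv_sP.
set s := inv_s A in cE s_gt0 *.
have sp_gt0 : (0 < s * p.-1)%N.
  by rewrite muln_gt0 s_gt0 -ltnS prednK ?prime_gt1 ?prime_gt0.
pose d := c - E ^+ s * w ^+ (s * p.-1).-1.
have dE : d *: (w *: a) = a *+ p ^ s - (E ^+ s * w ^+ (s * p.-1)) *: a.
  by rewrite /d [LHS]scalerBl -cE scalerA -mulrA -exprSr prednK.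
have [|i iE] := fixed_aug r_gt0 (c := d).
  rewrite dE scalerBr -scalerMnr scalerMnl (aug_pX p_prime g_gen g_ord epsP) scalerA.
  by rewrite (ga_mulC g_gen w) -mulrA -exprSr subrr.
have i_lt : (i < (Zp_trunc (pdiv p)).+2)%N by rewrite Fp_cast.
exists (Ordinal i_lt : 'F_p); apply/is_inv_tE => //.
rewrite [RHS]scalerDl -/s mulr_natl -scalerMnl [X in _ + X]/= -iE dE addrC subrK.
by [].
Qed.

End FiniteModule.

(** * The annihilator of a generator *)

Section FiniteModuleTheory.
Variables (p : nat) (p_prime : prime p) (gT : finGroupType) (g : gT).
Hypothesis g_gen : <[g]>%g = [set: gT].
Hypothesis g_ord : #|gT| = p.
Local Notation L := (group_algebra (padic p) gT).
Local Notation gg := (gelt g : L).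
Local Notation w := (gg - 1).
Variable eps : cyclo_int p.
Hypothesis epsP : is_eps eps.
Local Notation E := (cyclo_eval g eps).
Variables (A : finLmodType L) (a : A).
Hypothesis a_gen : mod_generator a.
Local Notation r := (inv_r g A).
Local Notation s := (inv_s A).
Local Notation t := (inv_t g eps A).

(** The invariant is defined through some generator; the defining equation is
    linear in the generator, so it passes to [a]. *)
Lemma inv_tP : (0 < r)%N -> (0 < s)%N -> is_inv_t g eps a t.
Proof.
move=> r_gt0 s_gt0; rewrite /inv_t (gtn_eqF r_gt0) (gtn_eqF s_gt0) /=.
case: pickP => [u /asboolP[a' a'_gen]|no_t] /=.
  move/(is_inv_tE p_prime g_gen g_ord _ _ _ r_gt0 s_gt0) => a'u.
  apply/(is_inv_tE p_prime g_gen g_ord _ _ _ r_gt0 s_gt0); have [d ->] := a'_gen a.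
  by rewrite scalerMnr a'u (ga_scaleC g_gen).
have [u au] := inv_t_exists p_prime g_gen g_ord epsP a_gen r_gt0 s_gt0.
by have /asboolP[] := no_t u; exists a.
Qed.

(** The digit of [c] modulo [w] and [p^s] is killed in A/wA, which has
    order [p^s]. *)
Lemma ann_digits c : c *: a = 0 -> exists c1 c2, c = c1 * w + c2 *+ p ^ s.
Proof.
have [_ [d dE] s_dvd] := inv_sP p_prime g_gen g_ord epsP a_gen.
have [i [c1 [c2 ->]]] := ga_digits p_prime g_gen s c => ca0.
suff i0 : val i = 0%N by exists c1; exists c2; rewrite [X in X%:R]i0 add0r.
have /s_dvd : exists e, a *+ i = e *: (w *: a).
  exists (- (c1 + c2 * d)); apply/eqP; rewrite scaleNr -addr_eq0; apply/eqP.
  rewrite -[RHS]ca0 2![in RHS]scalerDl scaler_nat -addrA; congr (_ + _).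
  rewrite [LHS]scalerDl; congr (_ + _); first by rewrite scalerA.
  by rewrite -scalerA -dE -scalerMnl scalerMnr.
by case: (posnP i) => // i_gt0; rewrite gtnNdvd.
Qed.

(** The second generator of [M] when [r] and [s] are positive. *)
Definition rel_elt : L := (p ^ s)%:R - E ^+ s * w ^+ (s * p.-1) - (t : nat)%:R * w ^+ r.

Lemma rel_elt_ann : (0 < r)%N -> (0 < s)%N -> rel_elt *: a = 0.
Proof.
move=> r_gt0 s_gt0.
have /(is_inv_tE p_prime g_gen g_ord _ _ _ r_gt0 s_gt0) e := inv_tP r_gt0 s_gt0.
by rewrite /rel_elt -addrA -opprD [LHS]scalerBl scaler_nat e subrr.
Qed.

(** Modulo [rel_elt], which is [p^s] modulo [w], an annihilating element becomes
    a multiple [c3 w] of [w], and [c3 w a = 0] forces divisibility by w^(r+1). *)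
Lemma ann_rs c : (0 < r)%N -> (0 < s)%N ->
  c *: a = 0 <-> exists c1 c2, c = c1 * w ^+ r.+1 + c2 * rel_elt.
Proof.
move=> r_gt0 s_gt0; have u0 := rel_elt_ann r_gt0 s_gt0.
have [wr0 _] := inv_rP p_prime g_gen g_ord epsP a_gen.
have sp_gt0 : (0 < s * p.-1)%N.
  by rewrite muln_gt0 s_gt0 -ltnS prednK ?prime_gt1 ?prime_gt0.
split=> [ca0|[c1 [c2 ->]]]; last first.
  by rewrite [LHS]scalerDl -!scalerA u0 exprSr -scalerA wr0 !scaler0 addr0.
have [c1 [c2 cE]] := ann_digits ca0.
(* [c3] comes from writing [p ^ s] as [rel_elt] plus a multiple of [w]. *)
pose c3 := c1 + c2 * (E ^+ s * w ^+ (s * p.-1).-1 + (t : nat)%:R * w ^+ r.-1).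
have cE3 : c = c3 * w + c2 * rel_elt.
  rewrite cE /c3 mulrDl -addrA; congr (_ + _).
  rewrite -mulrA -mulrDr [X in c2 * (X + _)]mulrDl -!mulrA -!exprSr !prednK //.
  by rewrite /rel_elt -[(p ^ s)%:R - _ - _]addrA -opprD [X in c2 * X]addrC subrK mulr_natr.
move: c3 cE3 => c3 cE3; have [c4 c4E] : exists c4, c3 * w = c4 * w ^+ r.+1.
  apply: (ann_aug p_prime g_gen g_ord epsP a_gen).
  have u1 : (c2 * rel_elt) *: a = 0 by rewrite -scalerA u0 scaler0.
  by move: ca0; rewrite cE3 [LHS]scalerDl [X in _ + X = _]u1 addr0 -scalerA.
by exists c4; exists c2; rewrite cE3 c4E.
Qed.

Lemma ann_r0 c : r = 0%N -> c *: a = 0 <-> exists c1 c2, c = c1 * w + c2 * (p ^ s)%:R.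
Proof.
move=> r0; have [] := inv_rP p_prime g_gen g_ord epsP a_gen.
rewrite r0 scale1r => wa0 _; have [_ [d dE] _] := inv_sP p_prime g_gen g_ord epsP a_gen.
split=> [/ann_digits[c1 [c2 ->]]|[c1 [c2 ->]]].
  by exists c1; exists c2; rewrite mulr_natr.
by rewrite [LHS]scalerDl -!scalerA scaler_nat dE wa0 !scaler0 addr0.
Qed.

Lemma inv_s0P : s = 0%N <-> forall x : A, x = 0.
Proof.
have [cardF [d dE] _] := inv_sP p_prime g_gen g_ord epsP a_gen.
split=> [s0 x|A0].
  have [c ->] := a_gen x; rewrite (_ : a = 0) ?scaler0 //.
  by apply: (w_nakayama p_prime g_gen g_ord epsP (c := d)); rewrite -dE s0.
have : (#|fixed_points A| <= 1)%N.
  by apply/card_le1P => x _ y; rewrite (A0 y) (A0 x) !inE eqxx; apply/forallP => h; rewrite (A0 (ga_act _ _)).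
by rewrite cardF; case: (s) => // n; rewrite leqNgt -(exp1n n.+1) ltn_exp2r ?prime_gt1.
Qed.

End FiniteModuleTheory.

(** * Cyclic modules and their annihilators *)

Section CyclicModules.
Variable R : nzRingType.

(** The map sends [c u] to [c v]. *)
Lemma cyclic_iso (U V : lmodType R) (u : U) (v : V) :
    mod_generator u -> mod_generator v ->
    (forall c : R, c *: u = 0 <-> c *: v = 0) ->
  lmod_iso U V.
Proof.
move=> /choice[f fE] /choice[h hE] ann.
have annB c d : c *: u = d *: u <-> c *: v = d *: v.
  have [uv vu] := ann (c - d); split=> /eqP; rewrite -subr_eq0 -scalerBl => /eqP.
    by move/uv/eqP; rewrite scalerBl subr_eq0 => /eqP.
  by move/vu/eqP; rewrite scalerBl subr_eq0 => /eqP.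
have F_lin : linear (fun x : U => f x *: v).
  by move=> k x y; rewrite scalerA -scalerDl; apply/annB; rewrite -fE scalerDl -scalerA -!fE.
pose F : {linear U -> V} := HB.pack (fun x : U => f x *: v)
  (GRing.isLinear.Build R U V _ (fun x : U => f x *: v) F_lin).
exists F; exists (fun y => h y *: u) => [x|y] /=.
  by rewrite [RHS]fE; apply/annB; rewrite -hE.
by rewrite [RHS]hE; apply/annB; rewrite -fE.
Qed.

Lemma quot_module_generator (M : submodClosed R^o) :
  mod_generator (quot_proj M (1 : R^o)).
Proof.
move=> x; exists (quot_repr x : R); rewrite -linearZ /=.
by rewrite -[RHS]/(quot_proj M ((quot_repr x : R) * 1)) mulr1 quot_reprK.
Qed.

Lemma quot_module_ann (M : submodClosed R^o) (c : R) :
  c *: quot_proj M (1 : R^o) = 0 <-> (c : R^o) \in M.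
Proof.
rewrite -linearZ -(linear0 (quot_proj M)) /=.
rewrite -[X in quot_proj M X = _]/(c * 1) mulr1.
by split=> [/quot_projP|cM]; [|apply/quot_projP]; rewrite subr0.
Qed.

Lemma iso_generator (U V : lmodType R) (v : V) : lmod_iso U V -> mod_generator v ->
  exists2 u : U, mod_generator u & forall c : R, c *: u = 0 <-> c *: v = 0.
Proof.
move=> [f [h fK hK]] v_gen.
have fZ c : f (c *: h v) = c *: v by rewrite linearZ hK.
exists (h v) => [x|c].
  by have [c e] := v_gen (f x); exists c; rewrite -[x]fK e -fZ fK.
split=> [c0|c0]; first by rewrite -fZ c0 linear0.
by rewrite -[LHS]fK fZ c0 -(linear0 f) fK.
Qed.

Lemma rank1_generator (V : lmodType R) : rank1 V -> exists v : V, mod_generator v.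
Proof.
by case=> M /iso_generator/(_ (@quot_module_generator M))[v v_gen _]; exists v.
Qed.

Definition annihilator (V : lmodType R) (v : V) : {pred R^o} :=
  fun c => (c : R) *: v == 0.

Fact annihilator_submod_closed (V : lmodType R) (v : V) : submod_closed (annihilator v).
Proof.
split=> [|c x y /eqP xv /eqP yv]; rewrite unfold_in /annihilator; first by rewrite scale0r.
by rewrite scalerDl yv addr0 -[c *: x]/(c * x) -scalerA xv scaler0.
Qed.

HB.instance Definition _ (V : lmodType R) (v : V) :=
  GRing.isSubmodClosed.Build R R^o (annihilator v) (annihilator_submod_closed v).

Lemma span_mod2P (V : lmodType R) (x y v : V) :
  v \in span_mod [:: x; y] <-> exists c d, v = c *: x + d *: y.
Proof.
rewrite unfold_in /span_mod; split=> [/asboolP[c ->]|[c [d ->]]].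
  by exists (c ord0); exists (c (lift ord0 ord0)); rewrite !big_ord_recl big_ord0 addr0.
apply/asboolP; exists (fun i => if val i == 0%N then c else d).
by rewrite !big_ord_recl big_ord0 addr0.
Qed.

End CyclicModules.

(** * Tate cohomology in degree 0 *)

Section TateZero.
Variables (R : comNzRingType) (gT : finGroupType).
Local Notation L := (group_algebra R gT).

(** A fixed element is a constant 0-cocycle. If it comes from an equivariant
    cochain in degree -1, then it is the norm of the value of that cochain
    at 1. *)
Lemma tate_zero_norm (V : lmodType L) :
    tate_vanish V [set: gT]%G 0%Z ->
  forall x : V, (forall h, ga_act h x = x) -> exists y, x = (\sum_h (gelt h : L)) *: y.
Proof.
move=> H0 x fix_x.
have [|y eqy yx] := H0 (fun _ => x : V).
  split; first by move=> h s; rewrite fix_x.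
  by move=> s; rewrite /d_pos !big_ord_recl big_ord0 addr0 expr0 expr1 scale1r scaleN1r subrr.
pose one_tuple : {ffun 'I_1 -> subg_of [set: gT]%G} := [ffun=> 1%g].
exists (y one_tuple); rewrite [LHS](yx one_tuple) /d_norm scaler_suml.
rewrite (reindex (subg [set: gT])) /=.
  apply: eq_bigr => h _; rewrite -[RHS]/(ga_act h (y one_tuple)).
  rewrite -[X in ga_act X _](@subgK _ [set: gT] h) ?inE // -eqy; congr y.
  by apply/ffunP => i; rewrite !ffunE mulg1.
by exists sgval => h _; rewrite ?subgK ?sgvalK ?inE.
Qed.

Lemma zero_cohomologically_trivial (V : lmodType L) :
  (forall x : V, x = 0) -> cohomologically_trivial V.
Proof.
move=> V0 H [[|n]|n] x _; exists (fun=> 0).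
all: by [move=> h s; rewrite /ga_act scaler0 | move=> s; rewrite (V0 (x s)) [RHS]V0].
Qed.

End TateZero.

(** * Cohomological triviality and the invariant [t] *)

Section CohomologyOfCyclicModule.
Variables (p : nat) (p_prime : prime p) (gT : finGroupType) (g : gT).
Hypothesis g_gen : <[g]>%g = [set: gT].
Hypothesis g_ord : #|gT| = p.
Local Notation L := (group_algebra (padic p) gT).
Local Notation gg := (gelt g : L).
Local Notation w := (gg - 1).
Variable eps : cyclo_int p.
Hypothesis epsP : is_eps eps.
Local Notation E := (cyclo_eval g eps).
Variables (A : finLmodType L) (a : A).
Hypothesis a_gen : mod_generator a.
Local Notation r := (inv_r g A).
Local Notation s := (inv_s A).
Local Notation t := (inv_t g eps A).
Hypotheses (r_gt0 : (0 < r)%N) (s_gt0 : (0 < s)%N).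
Local Notation u := (rel_elt g eps A).

Let sp_gt0 : (0 < s * p.-1)%N.
Proof. by rewrite muln_gt0 s_gt0 -ltnS prednK ?prime_gt1 ?prime_gt0. Qed.

(** The first two terms of [u] cancel, since [p w = E w^p]. *)
Lemma aug_rel_elt : w * u = - ((t : nat)%:R * w ^+ r.+1).
Proof.
rewrite /rel_elt !mulrBr mulr_natr (aug_pX p_prime g_gen g_ord epsP).
rewrite [w * (E ^+ s * _)](ga_mulC g_gen) -mulrA -exprSr subrr sub0r.
by rewrite (ga_mulC g_gen w) -mulrA -exprSr.
Qed.

Lemma t_unit : t != 0 -> exists v : L, v * (t : nat)%:R = 1.
Proof.
move=> t_neq0; have t_lt : (t < p)%N.
  by have := ltn_ord t; rewrite [X in (_ < X)%N]Fp_cast.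
have [v tv] : exists v : padic p, (t : nat)%:R * v = 1.
  apply: (padic_nat_unit p_prime); rewrite coprime_sym prime_coprime // gtnNdvd //.
  by rewrite lt0n; apply: contra t_neq0 => /eqP t0; apply/eqP/ord_inj.
by exists v%:A; rewrite mulr_natr scalerMnl -mulr_natl tv scale1r.
Qed.

Lemma aug_X_reg n (x : L) : w ^+ n.+1 * x = 0 -> w * x = 0.
Proof.
elim: n x => [//|n IHn] x e; apply: (aug_sq_reg p_prime g_gen g_ord epsP).
by rewrite expr2 -mulrA; apply: IHn; rewrite mulrA -exprSr.
Qed.

(** If [u c = 0] then t w^(r+1) c = 0, hence [w c = 0]; on such [c] the element
    [u] acts as [p^s]. *)
Lemma rel_elt_reg : t != 0 -> forall c, u * c = 0 -> c = 0.
Proof.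
move=> /t_unit[v vt] c uc0.
have wc0 : w * c = 0.
  apply: (@aug_X_reg r); have := congr1 (fun x => - (v * (w * x))) uc0.
  rewrite !mulr0 oppr0 [w * _]mulrA aug_rel_elt mulNr mulrN opprK.
  by rewrite [v * _]mulrA [v * _]mulrA vt mul1r.
have wXc n : (0 < n)%N -> w ^+ n * c = 0 by case: n => // n _; rewrite exprSr -mulrA wc0 mulr0.
have ptf n (x : L) : x *+ p ^ n = 0 -> x = 0.
  elim: n x => [//|n IHn] x; rewrite expnS mulrnA => /IHn.
  exact: (ga_torsion_free p_prime).
apply: (ptf s); rewrite -mulr_natl -[RHS]uc0 /rel_elt !mulrBl -!mulrA !wXc //.
by rewrite !mulr0 !subr0.
Qed.

(** The other generator w^(r+1) is a multiple of [u], by [aug_rel_elt]. *)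
Lemma ann_rel_elt : t != 0 -> forall c, c *: a = 0 <-> exists c', c = u * c'.
Proof.
move=> /t_unit[v vt] c.
have annE d := ann_rs p_prime g_gen g_ord epsP a_gen d r_gt0 s_gt0.
split=> [/annE[c1 [c2 ->]]|[c' ->]]; last first.
  by apply/annE; exists 0; exists c'; rewrite mul0r add0r (ga_mulC g_gen).
exists (c2 - c1 * v * w); rewrite [RHS](ga_mulC g_gen) mulrBl addrC; congr (_ + _).
rewrite -[_ * w * u]mulrA aug_rel_elt mulrN opprK -[RHS]mulrA [v * _]mulrA vt.
by rewrite mul1r.
Qed.

Lemma cohomologically_trivial_t : t != 0 -> cohomologically_trivial A.
Proof.
move=> t_neq0; apply: (cohomologically_trivial_regular_quotient (u := u) a_gen).
- by move=> c; apply: ga_mulC g_gen _ _.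
- exact: rel_elt_reg.
- exact: ann_rel_elt.
Qed.

(** From [ga_normE] and [p w = E w^p] one gets p^(s-1) N = u + t w^r. *)
Lemma norm_t0 : t = 0 -> ga_norm p g *: a *+ p ^ s.-1 = 0.
Proof.
move=> t0; rewrite scalerMnl.
suff -> : ga_norm p g *+ p ^ s.-1 = u + (t : nat)%:R * w ^+ r.
  rewrite [LHS]scalerDl (rel_elt_ann p_prime g_gen g_ord epsP) // t0 mul0r scale0r.
  by rewrite addr0.
rewrite /rel_elt subrK (ga_normE p_prime g_gen g_ord epsP) mulrnBl -mulrnA -expnS prednK //.
congr (_ - _); have wX : w ^+ p.-1 = w * w ^+ p.-2.
  by rewrite -exprS; case: p p_prime => [|[|]].
rewrite wX -mulrnAr -mulrnAl (aug_pX p_prime g_gen g_ord epsP).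
rewrite -[_ * _ * w ^+ _]mulrA -exprD mulrA -exprS prednK //; congr (_ * _ ^+ _).
have e q k : (1 < q)%N -> ((k * q.-1).+1 + q.-2 = k.+1 * q.-1)%N.
  by case: q => [|[|q]] //= _; rewrite mulSn addSnnS addnC.
by rewrite e ?prime_gt1 // prednK.
Qed.

(** Since [w N = 0] and p^(s-1) N a = 0, the norms are the multiples [i N a]
    with i < p^(s-1), too few to exhaust the p^s fixed points. *)
Lemma not_cohomologically_trivial_t0 : t = 0 -> ~ cohomologically_trivial A.
Proof.
move=> t0 /(_ [set: gT]%G 0%Z)/tate_zero_norm H0; have N0 := norm_t0 t0.
have [cardF _ _] := inv_sP p_prime g_gen g_ord epsP a_gen.
have : fixed_points A \subset
    [set ga_norm p g *: a *+ val i | i in [set: 'I_(p ^ s.-1)]].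
  apply/subsetP => x; rewrite inE => /forallP fx.
  have [y ->] : exists y, x = (\sum_h (gelt h : L)) *: y by apply: H0 => h; apply/eqP.
  rewrite -(ga_norm_sum g_gen g_ord); have [c ->] := a_gen y.
  have [i [c1 [c2 ->]]] := ga_digits p_prime g_gen s.-1 c.
  apply/imsetP; exists i; rewrite ?inE // scalerA (ga_mulC g_gen) !mulrDl.
  rewrite -mulrA ga_norm_aug // mulr0 addr0 [LHS]scalerDl mulr_natl -scalerMnl.
  rewrite [X in _ + X](_ : _ = 0) ?addr0 // mulrnAl -mulrnAr -scalerA.
  by rewrite -[(ga_norm p g *+ _) *: a]scalerMnl N0 scaler0.
move/subset_leq_card; rewrite cardF => /leq_trans/(_ (leq_imset_card _ _)).
rewrite cardsT card_ord leqNgt ltn_exp2l ?prime_gt1 //.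
by rewrite prednK // leqnn.
Qed.

End CohomologyOfCyclicModule.

(** * Classification by the invariants *)

Section Classification.
Variables (p : nat) (p_prime : prime p) (gT : finGroupType) (g : gT).
Hypothesis g_gen : <[g]>%g = [set: gT].
Hypothesis g_ord : #|gT| = p.
Local Notation L := (group_algebra (padic p) gT).
Local Notation gg := (gelt g : L).
Local Notation w := (gg - 1).
Variable eps : cyclo_int p.
Hypothesis epsP : is_eps eps.
Local Notation E := (cyclo_eval g eps).

Lemma cyclo_act_rel (s : nat) : (0 < s)%N ->
  cyclo_act g (eps ^+ s) (w ^+ (s * p.-1) : L^o) = E ^+ s * w ^+ (s * p.-1) :> L.
Proof.
move=> s_gt0; have sp_gt0 : (0 < s * p.-1)%N.
  by rewrite muln_gt0 s_gt0 -ltnS prednK ?prime_gt1 ?prime_gt0.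
rewrite -[LHS]/(cyclo_eval g (eps ^+ s) * w ^+ (s * p.-1)) -(prednK sp_gt0) exprS !mulrA.
congr (_ * _); rewrite -(ga_mulC g_gen w) (cyclo_evalX p_prime g_gen g_ord).
exact: (ga_mulC g_gen).
Qed.

Lemma ann_invariants (A A' : finLmodType L) (a : A) (a' : A') :
    mod_generator a -> mod_generator a' ->
    inv_r g A' = inv_r g A -> inv_s A' = inv_s A -> inv_t g eps A' = inv_t g eps A ->
  forall c : L, c *: a' = 0 <-> c *: a = 0.
Proof.
move=> a_gen a'_gen er es et c.
have [s0|s_gt0] := posnP (inv_s A).
  have /(inv_s0P p_prime g_gen g_ord epsP a_gen) A0 := s0.
  have /(inv_s0P p_prime g_gen g_ord epsP a'_gen) A'0 := etrans es s0.
  by split=> _; [apply: A0 | apply: A'0].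
have [r0|r_gt0] := posnP (inv_r g A).
  have := ann_r0 p_prime g_gen g_ord epsP a_gen c r0.
  have := ann_r0 p_prime g_gen g_ord epsP a'_gen c (etrans er r0).
  by rewrite es => -> <-.
have := ann_rs p_prime g_gen g_ord epsP a_gen c r_gt0 s_gt0.
have := ann_rs p_prime g_gen g_ord epsP a'_gen c.
by rewrite /rel_elt er es et => /(_ r_gt0 s_gt0) -> <-.
Qed.

Lemma trivial_action (A : finLmodType L) (a : A) : mod_generator a ->
  inv_r g A = 0%N -> forall (h : gT) (x : A), ga_act h x = x.
Proof.
move=> a_gen r0 h x; have [] := inv_rP p_prime g_gen g_ord epsP a_gen.
rewrite r0 scale1r => wa0 _.
have : x \in fixed_points A.
  by rewrite (fixed_pointsE g_gen) inE; apply/eqP/(ann_generator g_gen a_gen).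
by rewrite inE => /forallP/(_ h)/eqP.
Qed.

(** With trivial action the norm is multiplication by [p], so [A = p A]. *)
Lemma trivial_action_cohomology (A : finLmodType L) (a : A) : mod_generator a ->
  inv_r g A = 0%N -> cohomologically_trivial A -> forall x : A, x = 0.
Proof.
move=> a_gen r0 /(_ [set: gT]%G 0%Z)/tate_zero_norm H0.
have triv := trivial_action a_gen r0.
have [y aE] := H0 a (fun h => triv h a).
have [c yE] := a_gen y.
have a0 : a = 0.
  apply: (p_nakayama p_prime (c := c)); rewrite {1}aE scaler_suml.
  rewrite (eq_bigr (fun=> y)); last by move=> h _; exact: triv.
  by rewrite sumr_const g_ord {1}yE scalerMnr.
by move=> x; have [d ->] := a_gen x; rewrite a0 scaler0.
Qed.

End Classification.

Theorem theorem2p4 (p : nat) (p_prime : prime p) (gT : finGroupType) (g : gT)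
    (g_gen : <[g]>%g = [set: gT]) (g_ord : #|gT| = p)
    (eps : cyclo_int p) (eps_def : is_eps eps)
    (A : finLmodType (group_algebra (padic p) gT)) (A_rank1 : rank1 A) :
  let L := group_algebra (padic p) gT in
  let r := inv_r g A in
  let s := inv_s A in
  let t := inv_t g eps A in
  let w : L := gelt g - 1 in
  [/\
      exists M : submodClosed L^o,
        [/\ lmod_iso A (quot_module M),
            forall M' : submodClosed L^o,
              lmod_iso A (quot_module M') -> M' =i M,
            s = 0%N -> M =i predT,
            r = 0%N -> (1 <= s)%N ->
              M =i span_mod [:: w : L^o; (p ^ s)%:R : L^o]
          & (1 <= r)%N -> (1 <= s)%N ->
              M =i span_mod
                [:: w ^+ r.+1 : L^o;
                    ((p ^ s)%:R
                     - cyclo_act g (eps ^+ s) (w ^+ (s * p.-1) : L^o)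
                     - (t : nat)%:R * w ^+ r : L) : L^o]],
      forall A' : finLmodType L,
        rank1 A' -> inv_r g A' = r -> inv_s A' = s -> inv_t g eps A' = t ->
        lmod_iso A' A,
      (1 <= r)%N -> (1 <= s)%N -> (cohomologically_trivial A <-> t != 0)
    & (r * s = 0)%N ->
        [/\ forall (h : gT) (x : A), ga_act h x = x,
            cohomologically_trivial A <-> s = 0%N
          & s = 0%N <-> forall x : A, x = 0]].
Proof.
have [a a_gen] := rank1_generator A_rank1.
have annP (c : group_algebra (padic p) gT) :
    reflect (c *: a = 0) ((c : (group_algebra (padic p) gT)^o) \in annihilator a).
  exact: eqP.
move=> L r s t w.
have s0P := inv_s0P p_prime g_gen g_ord eps_def a_gen.
split.
- exists (annihilator a : submodClosed L^o); split.
  + apply: (cyclic_iso a_gen (@quot_module_generator _ _)) => c.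
    by split=> [/annP/quot_module_ann|/quot_module_ann/annP].
  + move=> M' /iso_generator/(_ (@quot_module_generator _ M'))[a' a'_gen a'M'] c.
    have aa' : c *: a = 0 <-> c *: a' = 0.
      by split=> ca0; [apply: (ann_generator g_gen a_gen) | apply: (ann_generator g_gen a'_gen)].
    apply/idP/annP => [/quot_module_ann/a'M'/aa' //|/aa'/a'M'/quot_module_ann//].
  + by move=> /s0P A0 c; apply/annP/A0.
  + move=> r0 _ c; have annE := ann_r0 p_prime g_gen g_ord eps_def a_gen c r0.
    by apply/annP/idP => [/annE/(span_mod2P (V := L^o))|/(span_mod2P (V := L^o))/annE].
  + move=> r_gt0 s_gt0 c; have annE := ann_rs p_prime g_gen g_ord eps_def a_gen c r_gt0 s_gt0.
    rewrite (cyclo_act_rel p_prime g_gen g_ord) //.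
    by apply/annP/idP => [/annE/(span_mod2P (V := L^o))|/(span_mod2P (V := L^o))/annE].
- move=> A' /rank1_generator[a' a'_gen] er es et; apply: (cyclic_iso a'_gen a_gen).
  exact: (ann_invariants p_prime g_gen g_ord eps_def).
- move=> r_gt0 s_gt0; split.
    apply: contraPneq => t0.
    exact: (not_cohomologically_trivial_t0 p_prime g_gen g_ord eps_def a_gen).
  exact: (cohomologically_trivial_t p_prime g_gen g_ord eps_def a_gen).
move=> /eqP; rewrite muln_eq0 => rs0.
have A0_triv : s = 0%N -> forall (h : gT) (x : A), ga_act h x = x.
  by move=> /s0P A0 h x; rewrite [LHS]A0 [RHS]A0.
split=> //.
- by case/orP: rs0 => /eqP; [apply: (trivial_action p_prime g_gen g_ord eps_def a_gen) | ].
- split=> [coh|/s0P A0]; last exact: zero_cohomologically_trivial.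
  case/orP: rs0 => /eqP // r0; apply/s0P.
  exact: (trivial_action_cohomology p_prime g_gen g_ord eps_def a_gen).
Qed.
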